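(* Let $n\ge3$, let $k$ be a real constant, and for $f\in L^p(\mathbb{R}^{n-1})$ let $$u(x)=k\int_{\mathbb{R}^{n-1}}\frac{f(y')}{|y-x|^{\beta}}\,dy',\qquad x\in\mathbb{R}^n_+,\ y=(y',0).$$ Let any of the following conditions hold: (i) $\beta\ge n-1$ and $p\in[1,\infty)$; (ii) $\beta>n-1$ and $p=\infty$; (iii) $\beta<n-1$ and $p\in[1,(n-1)/(n-1-\beta))$. Then for any $x\in\mathbb{R}^n_+$ the sharp constant $C_{0,\beta,p}$ in the inequality $$|\nabla u(x)|\le\frac{C_{0,\beta,p}}{x_n^{\,2-n+\beta+((n-1)/p)}}\,\|f\|_p$$ is given by $C_{0,\beta,1}=|k|\beta$, and $$C_{0,\beta,p}=|k|\beta\left\{\frac{\pi^{\frac{n-1}{2}}\,\Gamma\left(\frac{(\beta-n+3)p+n-1}{2(p-1)}\right)}{\Gamma\left(\frac{(\beta+2)p}{2(p-1)}\right)}\right\}^{\frac{p-1}{p}}$$ for $p>1$. The constant $C_{0,\beta,p}$ is sharp under these conditions also in the weaker inequality obtained by replacing $\nabla u$ by $\partial u/\partial x_n$.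
   Context: $\mathbb{R}^n_+=\{x=(x',x_n):x'\in\mathbb{R}^{n-1},\ x_n>0\}$. $\|\cdot\|_p$ is the norm of $L^p(\mathbb{R}^{n-1})$ (real-valued functions). For $p=\infty$ the expressions in $p$ are understood as limits as $p\to\infty$: $(n-1)/p=0$, $\frac{(\beta-n+3)p+n-1}{2(p-1)}=\frac{\beta-n+3}{2}$, $\frac{(\beta+2)p}{2(p-1)}=\frac{\beta+2}{2}$, $\frac{p-1}{p}=1$. ''Sharp constant'' means the smallest constant for which the inequality holds for all $f\in L^p(\mathbb{R}^{n-1})$ (at the given $x$). *)

(* Defs.v *)
From HB Require Import structures.
From mathcomp Require Import all_boot all_order all_algebra.
From mathcomp Require Import all_classical all_reals all_analysis.

Set Implicit Arguments.
Unset Strict Implicit.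
Unset Printing Implicit Defensive.
Import Order.TTheory GRing.Theory Num.Theory.
Import numFieldNormedType.Exports.

Local Open Scope classical_set_scope.
Local Open Scope ring_scope.

(* The library has no Lebesgue measure on R^m. It is built here by recursion on
   m: the measure on R^(m+1) is the image of the product measure on R x R^m
   under (t, y) |-> t :: y. *)
Section lebesgue_cons.
Context {R : realType} {m : nat}.
Local Notation Q := (measurableTypeR R).

Definition tuple_of_pair (z : Q * m.-tuple Q) : m.+1.-tuple Q :=
  [tuple of z.1 :: z.2].

Definition pair_of_tuple (y : m.+1.-tuple Q) : Q * m.-tuple Q :=
  (thead y, [tuple of behead y]).

Lemma tuple_of_pairK : cancel tuple_of_pair pair_of_tuple.
Proof.
move=> [t y]; rewrite /pair_of_tuple /tuple_of_pair /=; congr pair.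
exact: val_inj.
Qed.

Lemma measurable_tuple_of_pair : measurable_fun setT tuple_of_pair.
Proof. exact: measurable_cons measurable_fst measurable_snd. Qed.

Lemma measurable_pair_of_tuple : measurable_fun setT pair_of_tuple.
Proof.
apply/measurable_fun_pairP; split; first exact: measurable_tnth.
exact: measurable_behead.
Qed.

Variable mu : {sigma_finite_measure set (m.-tuple Q) -> \bar R}.

Definition lebesgue_cons : set (m.+1.-tuple Q) -> \bar R :=
  pushforward (@lebesgue_measure R \x mu)%E tuple_of_pair.

Let lebesgue_cons0 : lebesgue_cons set0 = 0%E.
Proof. by rewrite /lebesgue_cons /pushforward preimage_set0 measure0. Qed.

Let lebesgue_cons_ge0 A : (0 <= lebesgue_cons A)%E.
Proof. by rewrite /lebesgue_cons /pushforward measure_ge0. Qed.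

Let lebesgue_cons_sigma_additive : semi_sigma_additive lebesgue_cons.
Proof.
have mf A : measurable A -> measurable (tuple_of_pair @^-1` A).
  move=> mA; rewrite -[X in measurable X]setTI.
  exact: measurable_tuple_of_pair.
move=> F mF tF mUF; rewrite /lebesgue_cons /pushforward preimage_bigcup.
apply: measure_semi_sigma_additive.
- by move=> n; exact: mf.
- apply/trivIsetP => /= i j _ _ ij; rewrite -preimage_setI.
  by move/trivIsetP : tF => /(_ _ _ _ _ ij) ->//; rewrite preimage_set0.
- by rewrite -preimage_bigcup; exact: mf.
Qed.

HB.instance Definition _ := isMeasure.Build _ _ _ lebesgue_cons
  lebesgue_cons0 lebesgue_cons_ge0 lebesgue_cons_sigma_additive.

Let lebesgue_cons_sigma_finite : sigma_finite setT lebesgue_cons.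
Proof.
have /sigma_finiteP[F [TF ndF Foo]] := sigma_finiteT (@lebesgue_measure R).
have /sigma_finiteP[G [TG ndG Goo]] := sigma_finiteT mu.
exists (fun n => pair_of_tuple @^-1` (F n `*` G n)).
  rewrite -preimage_bigcup (_ : \bigcup_n _ = setT) ?preimage_setT//.
  rewrite -subTset => -[t y] _.
  have [i _ Fit] : (\bigcup_n F n) t by rewrite -TF.
  have [j _ Gjy] : (\bigcup_n G n) y by rewrite -TG.
  exists (maxn i j) => //; split => /=.
  - by move: t Fit; exact/subsetPset/ndF/leq_maxl.
  - by move: y Gjy; exact/subsetPset/ndG/leq_maxr.
move=> n; have [mF Fn] := Foo n; have [mG Gn] := Goo n; split.
  rewrite -[X in measurable X]setTI.
  apply: measurable_pair_of_tuple => //; exact: measurableX.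
rewrite /lebesgue_cons /pushforward -comp_preimage.
rewrite (_ : pair_of_tuple \o tuple_of_pair = id); last first.
  by rewrite funeqE; exact: tuple_of_pairK.
by rewrite preimage_id product_measure1E// lte_mul_pinfty// ge0_fin_numE.
Qed.

HB.instance Definition _ := Measure_isSigmaFinite.Build _ _ _ lebesgue_cons
  lebesgue_cons_sigma_finite.

End lebesgue_cons.

Fixpoint lebesgueRn (R : realType) (m : nat) :
    {sigma_finite_measure set (m.-tuple (measurableTypeR R)) -> \bar R} :=
  match m with
  | 0 => @dirac _ (0.-tuple (measurableTypeR R)) [tuple] R
  | m'.+1 => lebesgue_cons (lebesgueRn R m')
  end.

Section potential.
Context {R : realType}.

Definition Gamma (s : R) : R :=
  \int[lebesgue_measure]_(t in `]0, +oo[) (t `^ (s - 1) * expR (- t)).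

Definition eucl {d : nat} (v : 'rV[R]_d) : R :=
  Num.sqrt (\sum_(i < d) (v 0 i) ^+ 2).

Definition last_coord {m : nat} (x : 'rV[R]_m.+1) : R := x 0 ord_max.

(* [(y', 0)]: the entry of index [m] is out of range for [y], hence is the
   default value 0. *)
Definition bdry_pt {m : nat} (y : m.-tuple (measurableTypeR R)) : 'rV[R]_m.+1 :=
  \row_i nth (0 : R) y i.

Definition integrand {m : nat} (beta : R)
    (f : m.-tuple (measurableTypeR R) -> R) (x : 'rV[R]_m.+1)
    (y : m.-tuple (measurableTypeR R)) : R :=
  f y / eucl (bdry_pt y - x) `^ beta.

(* Only meaningful for [x] with [0 < last_coord x]. *)
Definition potential {m : nat} (k beta : R)
    (f : m.-tuple (measurableTypeR R) -> R) (x : 'rV[R]_m.+1) : R :=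
  k * \int[lebesgueRn R m]_y integrand beta f x y.

Definition partial {d : nat} (i : 'I_d) (u : 'rV[R]_d -> R) (x : 'rV[R]_d) : R :=
  'D_(delta_mx 0 i) u x.

Definition grad {d : nat} (u : 'rV[R]_d -> R) (x : 'rV[R]_d) : 'rV[R]_d :=
  \row_i partial i u x.

(* [a / p], read as 0 when [p] is infinite *)
Definition over (a : R) (p : \bar R) : R :=
  if p is r%:E then a / r else 0.

Definition admissible (n : nat) (beta : R) (p : \bar R) : Prop :=
  [\/ [/\ n%:R - 1 <= beta, (1 <= p)%E & (p < +oo)%E],
      n%:R - 1 < beta /\ p = +oo%E
    | [/\ beta < n%:R - 1, (1 <= p)%E
        & (p < ((n%:R - 1) / (n%:R - 1 - beta))%:E)%E]].

(* For [p = +oo] the arguments of Gamma and the exponent are the limits of those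
   for finite [p]; the [-oo] branch is never reached. *)
Definition C0 (n : nat) (k beta : R) (p : \bar R) : R :=
  match p with
  | r%:E =>
      if r == 1 then `|k| * beta
      else `|k| * beta *
        (pi `^ ((n%:R - 1) / 2)
         * Gamma (((beta - n%:R + 3) * r + n%:R - 1) / (2 * (r - 1)))
         / Gamma (((beta + 2) * r) / (2 * (r - 1)))) `^ ((r - 1) / r)
  | +oo%E =>
      `|k| * beta *
        (pi `^ ((n%:R - 1) / 2)
         * Gamma ((beta - n%:R + 3) / 2) / Gamma ((beta + 2) / 2))
  | -oo%E => 0
  end.

(* The constants [C] valid at the point [x], for every f in L^p, in
   [Q u <= C / x_n ^ (2 - n + beta + (n - 1) / p) * ||f||_p],
   where [u] is the potential of [f] and [n = m + 1]. *)
Definition valid_constant {m : nat} (k beta : R) (p : \bar R)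
    (x : 'rV[R]_m.+1) (Q : ('rV[R]_m.+1 -> R) -> R) : set R :=
  let n := m.+1 in
  [set C | forall f : m.-tuple (measurableTypeR R) -> R,
    f \in Lfun (lebesgueRn R m) p ->
    ((Q (potential k beta f))%:E <=
     (C / last_coord x `^ (2 - n%:R + beta + over (n%:R - 1) p))%:E
       * 'N[lebesgueRn R m]_p[EFin \o f])%E].

Definition sharp_constant (S : set R) (C : R) : Prop := S C /\ lbound S C.

End potential.

(* Main.v *)
Require Import Defs.
From HB Require Import structures.
From mathcomp Require Import all_boot all_order all_algebra.
From mathcomp Require Import all_classical all_reals all_analysis.
From mathcomp Require Import measurable_realfun ess_sup_inf lebesgue_integral_under.
From mathcomp Require Import ring lra.

(** Write m = n - 1, h = x_n, rho(y) = |y - x| and w = y - x for a boundary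
    point y, and let q be the exponent conjugate to p.

    Differentiating under the integral sign (the differentiated kernel is
    dominated near x by a multiple of |f| rho^-beta, because moving x by at most
    h/2 changes rho at most by a factor 2) gives, for every vector v,
    grad u(x) . v = k beta int f (w . v) rho^-(beta+2) dy.
    By duality between L^p and L^q, the best constant in |grad u(x)| <= C |f|_p is
    |k| beta times the supremum over unit vectors v of the L^q norm of
    (w . v) rho^-(beta+2), and for the normal derivative it is the same expression
    with v normal to the boundary, in which case |w . v| = h. So everything
    reduces to showing that the normal direction is the worst one, and to
    computing one integral.

    For q finite put s = (beta+1) q - n and r = q + s. The integrability condition
    on p says exactly that beta q > m, which makes s positive. Young's inequality
    |w . v|^q h^s <= (q/r) |w . v|^r + (s/r) h^r then bounds the q-th power of the
    norm by integrals of |w . v|^r rho^-(r+n), homogeneous of degree -n in w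
    ([kernel_integral_le]). On the unit hemisphere seen from x such an integral is
    the spherical mean of |v . omega|^r, so it does not depend on the unit vector
    v ([ray_integral_rotate]) and equals its value in the normal direction, which
    is h^s times the integral of h^q rho^-((beta+2) q).

    Spherical coordinates are avoided: multiplying by the constant
    int |t|^(r+m) exp(-t^2) dt and scaling turns the homogeneous integral into a
    Gaussian integral over R x R^m of a function of one linear form, and the
    rotation invariance of Gaussians follows by induction from the plane case, a
    shear followed by Fubini ([gauss2_rotate], [integral_gauss_linform]). In the
    same way the integral of (h^2 + |y'|^2)^-b is a quotient of Gamma functions
    ([integral_powR_sqdist]): multiply by Gamma(b) and exchange the integrals.

    For p = 1 the dual norm is a supremum, bounded by rho^-(beta+1) <= h^-(beta+1)
    through Cauchy and Schwarz.

    The constants are attained by f = (h rho^-(beta+2))^(q-1) for p > 1, including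
    f = 1 for p = infinity, and are approached for p = 1 by indicators of small
    cubes around the foot point of x. *)

Set Implicit Arguments.
Unset Strict Implicit.
Unset Printing Implicit Defensive.
Import Order.TTheory GRing.Theory Num.Theory.
Import numFieldNormedType.Exports.

Local Open Scope classical_set_scope.
Local Open Scope ring_scope.

(** * Affine substitutions on the line *)

Lemma ge0_integralZ d (T : measurableType d) (R : realType)
    (m : {measure set T -> \bar R}) (k : R) (f : T -> \bar R) :
  0 <= k -> measurable_fun setT f -> (forall x, 0 <= f x)%E ->
  (\int[m]_x (k%:E * f x) = k%:E * \int[m]_x f x)%E.
Proof. by move=> k0 mf f0; rewrite ge0_integralZl. Qed.

Section affine_substitution.
Context {R : realType}.
Local Notation mu := (@lebesgue_measure R).
Local Notation Q := (measurableTypeR R).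
Implicit Types a b : R.

Lemma measurable_affine a b : measurable_fun setT (fun t : Q => a * t + b : Q).
Proof. by apply: measurable_funD => //; exact: measurable_funM. Qed.

(** Uniqueness of Lebesgue measure among the measures giving half-open
    intervals their length. *)
Lemma lebesgue_measure_affine a b (A : set Q) : 0 < a -> measurable A ->
  (a%:E * pushforward mu (fun t : Q => (a * t + b)%R : Q) A)%E = mu A.
Proof.
move=> a0 mA.
pose k : {nonneg R} := NngNum (ltW a0).
pose phi := fun t : Q => (a * t + b : Q).
have mphi : measurable_fun setT phi by exact: measurable_affine.
(* Bundling [phi] with its measurability makes the image of [mu] a measure. *)
pose HB1 := isMeasurableFun.Build _ _ _ _ _ mphi.
pose phim : {mfun Q >-> Q} := HB.pack phi HB1.
suff -> : (a%:E * pushforward mu phi A)%E = mscale k (pushforward mu phim) A.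
  apply/esym/lebesgue_measure_unique => // _ [[u v]] _ <-.
  pose S : set R := `](u - b) / a, (v - b) / a]%classic.
  have E : phi @^-1` `]u, v] = S.
    apply/seteqP; split => t /=; rewrite /S /= !in_itv/= /phi ltr_pdivrMr// ler_pdivlMr//;
    rewrite (mulrC t); lra.
  transitivity (a%:E * mu S)%E; last first.
    by congr (_ * mu _)%E; exact/esym/E.
  rewrite !lebesgue_measure_itv/= !lte_fin ltr_pM2r ?invr_gt0// ltrD2r.
  case: ifPn => uv; rewrite ?mule0// -!EFinB -EFinM; congr (_%:E).
  by field; rewrite gt_eqF.
by rewrite /mscale.
Qed.

Lemma ge0_integral_affine_pos a b (f : Q -> \bar R) : 0 < a ->
  measurable_fun setT f -> (forall t, 0 <= f t)%E ->
  (a%:E * \int[mu]_t f (a * t + b)%R)%E = (\int[mu]_t f t)%E.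
Proof.
move=> a0 mf f0.
pose k : {nonneg R} := NngNum (ltW a0).
pose phi := fun t : Q => (a * t + b : Q).
have mphi : measurable_fun setT phi by exact: measurable_affine.
have := ge0_integral_pushforward mphi mu measurableT mf (fun y _ => f0 y).
rewrite preimage_setT => <-; rewrite -(ge0_integral_mscale _ _ k)//.
by apply: eq_measure_integral => A mA _; exact: lebesgue_measure_affine.
Qed.

Lemma ge0_integral_opp (f : Q -> \bar R) :
  measurable_fun setT f -> (forall t, 0 <= f t)%E ->
  (\int[mu]_t f (- t)%R = \int[mu]_t f t)%E.
Proof.
move=> mf f0.
have mopp : measurable_fun setT (-%R : Q -> Q) by [].
have := ge0_integral_pushforward mopp mu measurableT mf (fun y _ => f0 y).
rewrite preimage_setT => <-.
by apply: eq_measure_integral => A mA _; exact: lebesgue_measureN.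
Qed.

Lemma ge0_integral_affine a b (f : Q -> \bar R) : a != 0 ->
  measurable_fun setT f -> (forall t, 0 <= f t)%E ->
  (`|a|%:E * \int[mu]_t f (a * t + b)%R)%E = (\int[mu]_t f t)%E.
Proof.
move=> a0 mf f0; have [aneg|apos|a00] := ltgtP a 0; last by rewrite a00 eqxx in a0.
- rewrite ltr0_norm// -[RHS](@ge0_integral_affine_pos (- a) b)// ?oppr_gt0//.
  congr (_ * _)%E; rewrite -[LHS]ge0_integral_opp//.
    by under eq_integral do rewrite mulrN -mulNr.
  exact: (measurableT_comp mf (measurable_affine a b)).
- by rewrite gtr0_norm// ge0_integral_affine_pos.
Qed.

Lemma ge0_integral_shift b (f : Q -> \bar R) :
  measurable_fun setT f -> (forall t, 0 <= f t)%E ->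
  (\int[mu]_t f (t - b)%R = \int[mu]_t f t)%E.
Proof.
move=> mf f0; rewrite -[RHS](@ge0_integral_affine 1 (- b))// normr1 mul1e.
by apply: eq_integral => t _; rewrite mul1r.
Qed.

Lemma integral_gauss_affine a b : a != 0 ->
  (\int[mu]_t (expR (- (a * t + b) ^+ 2))%:E)%E = (Num.sqrt pi / `|a|)%:E.
Proof.
move=> a0; have := @ge0_integral_affine a b (fun t => (gauss_fun t)%:E) a0.
rewrite integralT_gauss => /(_ _ _)/esym.
move=> h; rewrite EFinM h//.
- rewrite muleC muleA -EFinM mulVf ?normr_eq0// mul1e.
  by [].
- by apply/measurable_EFinP; exact: measurable_gauss_fun.
- by move=> t; rewrite lee_fin gauss_fun_ge0.
Qed.

Lemma integral_gauss_scale a : 0 < a ->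
  (\int[mu]_t (expR (- (a * t) ^+ 2))%:E)%E = (Num.sqrt pi / a)%:E.
Proof.
move=> a0; rewrite -{2}(gtr0_norm a0) -(@integral_gauss_affine a 0) ?gt_eqF//.
by apply: eq_integral => t _; rewrite addr0.
Qed.

End affine_substitution.

(** * Rotation invariance of the plane Gaussian *)

(** Structural measurability of an explicit expression. Dispatching on the head
    symbol keeps unification from unfolding the arithmetic of the reals. *)
Ltac mfun_step := first
  [ exact: measurable_id | exact: measurable_cst
  | exact: measurable_fst | exact: measurable_snd
  | eassumption
  | lazymatch goal with
    | |- measurable_fun _ (fun x => (_ * _)%E) => apply: emeasurable_funM
    | |- measurable_fun _ (fun x => _ * _) => apply: measurable_funM
    | |- measurable_fun _ (fun x => _ - _) => apply: measurable_funB
    | |- measurable_fun _ (fun x => _ + _) => apply: measurable_funD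
    | |- measurable_fun _ (fun x => - _) => apply: measurable_funN
    | |- measurable_fun _ (fun x => _ ^+ _) => apply: measurable_funX
    | |- measurable_fun _ ( *%R _) => exact: mulrl_measurable
    | |- measurable_fun _ ( +%R _) =>
        apply: measurable_funD; [exact: measurable_cst|exact: measurable_id]
    | |- measurable_fun _ expR => exact: measurable_expR
    | |- measurable_fun _ -%R => exact: oppr_measurable
    | |- measurable_fun _ (fun x => expR _) =>
        apply: (measurableT_comp (@measurable_expR _))
    | |- measurable_fun _ (fun x => _ `^ _) =>
        apply: (measurableT_comp (measurable_powR _))
    | |- measurable_fun _ (fun x => (_)%:E) => apply/measurable_EFinP
    | H : measurable_fun _ ?F |- measurable_fun _ (fun x => ?F _) =>
        apply: (measurableT_comp H)
    end ].
Ltac mfun := repeat mfun_step.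

Section gauss_rotation.
Context {R : realType}.
Local Notation mu := (@lebesgue_measure R).
Local Notation Q := (measurableTypeR R).

(** A Gaussian on the plane is rotation invariant. Only substitutions in one
    variable are used: the inner variable s is replaced by u with
    rho u = alpha t + beta s, where rho^2 = alpha^2 + beta^2, the order of
    integration is exchanged, and completing the square in t leaves a Gaussian
    factor in u. *)
Lemma gauss2_rotate (alpha beta kappa : R) (F : Q -> \bar R) :
  0 < kappa -> measurable_fun setT F -> (forall t, 0 <= F t)%E ->
  (\int[mu]_t \int[mu]_s (F (alpha * t + beta * s)%R
     * (expR (- ((kappa * t) ^+ 2 + (kappa * s) ^+ 2)))%:E) =
   (Num.sqrt pi / kappa)%:E * \int[mu]_s (F (Num.sqrt (alpha ^+ 2 + beta ^+ 2) * s)%R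
      * (expR (- (kappa * s) ^+ 2))%:E))%E.
Proof.
move=> k0 mF F0.
have [b0|b0] := eqVneq beta 0.
  transitivity (\int[mu]_t ((F (alpha * t)%R * (expR (- (kappa * t) ^+ 2))%:E) * (Num.sqrt pi / kappa)%:E))%E.
    apply: eq_integral => t _.
    transitivity (\int[mu]_s ((F (alpha * t)%R * (expR (- (kappa * t) ^+ 2))%:E) *
        (expR (- (kappa * s) ^+ 2))%:E))%E.
      apply: eq_integral => s _.
      by rewrite b0 mul0r addr0 opprD expRD EFinM muleA.
    rewrite ge0_integralZl//; last 2 first.
    - by mfun.
    - by rewrite mule_ge0// lee_fin expR_ge0.
    congr (_ * _)%E.
    by rewrite integral_gauss_scale.
  rewrite ge0_integralZr//; last 3 first.
  - mfun.
  - by move=> t _; rewrite mule_ge0// lee_fin expR_ge0.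
  - by rewrite lee_fin divr_ge0 ?sqrtr_ge0// ltW.
  rewrite muleC; congr (_ * _)%E.
  rewrite b0 expr0n/= addr0 sqrtr_sqr.
  have [a0|a0] := leP 0 alpha; first by rewrite ger0_norm.
  rewrite ltr0_norm// -[LHS]ge0_integral_opp; last 2 first.
  - mfun.
  - by move=> t; rewrite mule_ge0// lee_fin expR_ge0.
  by apply: eq_integral => t _; rewrite !mulrN mulNr sqrrN.
set rho := Num.sqrt (alpha ^+ 2 + beta ^+ 2).
have r20 : 0 < alpha ^+ 2 + beta ^+ 2.
  by rewrite ltr_wpDl ?sqr_ge0// lt0r sqrf_eq0 b0 sqr_ge0.
have rho0 : 0 < rho by rewrite sqrtr_gt0.
have rhon0 : rho != 0 by rewrite gt_eqF.
have kn0 : kappa != 0 by rewrite gt_eqF.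
have rb0 : rho / beta != 0 by rewrite mulf_neq0 ?invr_eq0.
have rho2 : rho ^+ 2 = alpha ^+ 2 + beta ^+ 2 by rewrite /rho sqr_sqrtr// ltW.
(* With s = (rho u - alpha t) / beta one has
   t^2 + s^2 = u^2 + ((rho t - alpha u) / beta)^2. *)
pose G (z : Q * Q) : \bar R := (`|rho / beta|%:E * (F (rho * z.2)%R *
  (expR (- (kappa * z.2) ^+ 2) * expR (- ((kappa * (rho / beta)) * z.1 + (- (kappa * alpha * z.2 / beta))) ^+ 2))%:E))%E.
transitivity (\int[mu]_t \int[mu]_u G (t, u))%E.
  apply: eq_integral => t _.
  rewrite -[LHS](@ge0_integral_affine _ (rho / beta) (- (alpha * t / beta))); last 3 first.
  - by [].
  - mfun.
  - by move=> s; rewrite mule_ge0// lee_fin expR_ge0.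
  rewrite -ge0_integralZl//; last 2 first.
  - mfun.
  - by move=> s _; rewrite mule_ge0// lee_fin expR_ge0.
  apply: eq_integral => u _; rewrite /G/=; congr (_ * (F _ * _%:E))%E.
    by field.
  rewrite -expRD; congr expR.
  apply/eqP; rewrite -subr_eq0; apply/eqP.
  transitivity (kappa ^+ 2 * (rho ^+ 2 - (alpha ^+ 2 + beta ^+ 2)) * (t ^+ 2 - u ^+ 2) / beta ^+ 2); last first.
    by rewrite rho2 subrr mulr0 !mul0r.
  by field.
rewrite fubini_tonelli; last 2 first.
- rewrite /G; mfun.
- by move=> z; rewrite /G !mule_ge0// lee_fin ?mulr_ge0 ?expR_ge0.
rewrite -ge0_integralZl//; last 3 first.
- mfun.
- by move=> s _; rewrite mule_ge0// lee_fin expR_ge0.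
- by rewrite lee_fin divr_ge0 ?sqrtr_ge0// ltW.
apply: eq_integral => u _; rewrite /G/=.
under eq_integral => t _ do rewrite EFinM !muleA.
rewrite ge0_integralZl//; last 2 first.
- mfun.
- by rewrite !mule_ge0// lee_fin ?expR_ge0.
rewrite integral_gauss_affine; last first.
  by rewrite mulf_neq0.
rewrite muleC !muleA; congr (_ * _ * _)%E; rewrite -EFinM; congr (_%:E).
rewrite !normrM (gtr0_norm k0) -mulrA; congr (_ * _).
rewrite invfM -mulrA mulVf ?mulr1// -normrM normr_eq0.
by [].
Qed.

End gauss_rotation.

(** * Lebesgue measure on R^m by recursion on the dimension *)

Section lebesgueRn_recursion.
Context {R : realType}.
Local Notation mu := (@lebesgue_measure R).
Local Notation Q := (measurableTypeR R).

(** The measure in dimension m + 1 is an image of a product measure, so that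
    Tonelli's theorem peels off the first coordinate. *)
Lemma ge0_integral_lebesgueRnS m (F : m.+1.-tuple Q -> \bar R) :
  measurable_fun setT F -> (forall y, 0 <= F y)%E ->
  (\int[lebesgueRn R m.+1]_y F y =
   \int[mu]_t \int[lebesgueRn R m]_y F (tuple_of_pair (t, y)))%E.
Proof.
move=> mF F0.
have mT := @measurable_tuple_of_pair R m.
have := ge0_integral_pushforward mT (mu \x lebesgueRn R m)%E measurableT mF
  (fun y _ => F0 y).
rewrite preimage_setT fubini_tonelli1; last 2 first.
- exact: (measurableT_comp mF mT).
- by move=> z /=.
by move=> <-; apply: eq_measure_integral.
Qed.

(** Centers and coefficients are sequences rather than tuples so that removing
    the first coordinate is composition with the successor. *)
Definition sqdist m (a : nat -> R) (y : m.-tuple Q) : R :=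
  \sum_(i < m) (tnth y i - a i) ^+ 2.

Definition linform m (z a : nat -> R) (y : m.-tuple Q) : R :=
  \sum_(i < m) z i * (tnth y i - a i).

Lemma sqdist_cons m a t (y : m.-tuple Q) :
  sqdist a (tuple_of_pair (t, y)) = (t - a 0%N) ^+ 2 + sqdist (a \o S) y.
Proof.
rewrite /sqdist big_ord_recl; congr (_ + _).
by apply: eq_bigr => i _; rewrite tnthS.
Qed.

Lemma linform_cons m z a t (y : m.-tuple Q) :
  linform z a (tuple_of_pair (t, y)) =
  z 0%N * (t - a 0%N) + linform (z \o S) (a \o S) y.
Proof.
rewrite /linform big_ord_recl; congr (_ + _).
by apply: eq_bigr => i _; rewrite tnthS.
Qed.

Lemma sqdist_ge0 m a (y : m.-tuple Q) : 0 <= sqdist a y.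
Proof. by apply: sumr_ge0 => i _; exact: sqr_ge0. Qed.

Lemma measurable_sqdist m a : measurable_fun setT (@sqdist m a).
Proof.
apply: measurable_sum => i; apply: measurable_funX; apply: measurable_funB => //.
exact: measurable_tnth.
Qed.

Lemma measurable_linform m z a : measurable_fun setT (@linform m z a).
Proof.
apply: measurable_sum => i; apply: measurable_funM => //.
by apply: measurable_funB => //; exact: measurable_tnth.
Qed.

Definition coord_norm m (z : nat -> R) : R := Num.sqrt (\sum_(i < m) z i ^+ 2).

(** Under a Gaussian on R^m a linear form is distributed like |z| times one
    coordinate: peel off a coordinate, apply the induction hypothesis to the
    others, and merge the two remaining Gaussian variables by [gauss2_rotate]. *)
Lemma integral_gauss_linform m (z a : nat -> R) (kappa : R) (F : Q -> \bar R) :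
  0 < kappa -> measurable_fun setT F -> (forall t, 0 <= F t)%E ->
  (\int[lebesgueRn R m]_y
     (F (linform z a y) * (expR (- (kappa ^+ 2 * sqdist a y)))%:E) =
   ((Num.sqrt pi / kappa) ^+ m * (kappa / Num.sqrt pi))%:E *
   \int[mu]_s (F (coord_norm m z * s)%R * (expR (- (kappa * s) ^+ 2))%:E))%E.
Proof.
move=> k0 mF F0.
have spi0 : Num.sqrt (pi : R) != 0 by rewrite gt_eqF// sqrtr_gt0 pi_gt0.
have kn0 : kappa != 0 by rewrite gt_eqF.
elim: m z a F mF F0 => [|m IH] z a F mF F0.
  rewrite [X in (X = _)%E]integral_dirac//; last first.
    mfun; [exact: measurable_linform|].
    by mfun; exact: measurable_sqdist.
  rewrite diracT mul1e /linform /sqdist /coord_norm !big_ord0 mulr0 oppr0 expR0 mule1.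
  rewrite sqrtr0 expr0 mul1r.
  under eq_integral do rewrite mul0r.
  rewrite ge0_integralZl//; last by mfun.
  rewrite integral_gauss_scale//.
  rewrite muleCA -EFinM (_ : _ * _ = 1) ?mule1//.
  by rewrite -invf_div mulVf// mulf_neq0 ?invr_eq0.
rewrite ge0_integral_lebesgueRnS; last 2 first.
- mfun; [exact: measurable_linform|].
  by mfun; exact: measurable_sqdist.
- by move=> y; rewrite mule_ge0// lee_fin expR_ge0.
set cm := ((Num.sqrt pi / kappa) ^+ m * (kappa / Num.sqrt pi)).
pose G t : \bar R := (cm%:E * \int[mu]_s (F (z 0%N * t + coord_norm m (z \o S) * s)%R
     * (expR (- ((kappa * t) ^+ 2 + (kappa * s) ^+ 2)))%:E))%E.
have cm0 : 0 <= cm by rewrite mulr_ge0 ?exprn_ge0// divr_ge0 ?sqrtr_ge0// ltW.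
have mH : measurable_fun setT (fun x : Q * Q => (F (z 0%N * x.1 + coord_norm m (z \o S) * x.2)%R *
    (expR (- ((kappa * x.1) ^+ 2 + (kappa * x.2) ^+ 2)))%:E)%E) by mfun.
have H0 : forall x : Q * Q, (0 <= F (z 0%N * x.1 + coord_norm m (z \o S) * x.2)%R *
    (expR (- ((kappa * x.1) ^+ 2 + (kappa * x.2) ^+ 2)))%:E)%E.
  by move=> x; rewrite mule_ge0// lee_fin expR_ge0.
transitivity (\int[mu]_t G (t - a 0%N)%R)%E.
  apply: eq_integral => t _.
  transitivity (\int[lebesgueRn R m]_y ((expR (- (kappa * (t - a 0%N)) ^+ 2))%:E *
    (F (z 0%N * (t - a 0%N) + linform (z \o S) (a \o S) y)%R
      * (expR (- (kappa ^+ 2 * sqdist (a \o S) y)))%:E)))%E.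
    apply: eq_integral => y _; rewrite linform_cons sqdist_cons.
    by rewrite (mulrDr (kappa ^+ 2)) opprD expRD EFinM muleCA exprMn.
  have mFt : measurable_fun setT (fun s : Q => F (z 0%N * (t - a 0%N) + s)%R) by mfun.
  rewrite ge0_integralZl//; last 2 first.
  - mfun; [exact: measurable_linform|].
    by mfun; exact: measurable_sqdist.
  - by move=> y _; rewrite mule_ge0// lee_fin expR_ge0.
  rewrite (IH _ _ (fun s => F (z 0%N * (t - a 0%N) + s)%R))// muleCA; congr (_ * _)%E.
  rewrite -ge0_integralZl//; last 2 first.
  - by mfun.
  - by move=> y _; rewrite mule_ge0// lee_fin expR_ge0.
  apply: eq_integral => s _; rewrite muleCA; congr (_ * _)%E.
  by rewrite -EFinM -expRD opprD.
have mG : measurable_fun setT G.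
  apply: emeasurable_funM => //.
  exact: (measurable_fun_fubini_tonelli_F _ mH H0).
have G0 t : (0 <= G t)%E.
  by rewrite mule_ge0// integral_ge0// => s _; exact: (H0 (t, s)).
rewrite ge0_integral_shift// /G ge0_integralZl//; last 2 first.
- exact: (measurable_fun_fubini_tonelli_F _ mH H0).
- by move=> t _; rewrite integral_ge0// => s _; exact: (H0 (t, s)).
rewrite gauss2_rotate// muleA -EFinM; congr (_%:E * _)%E.
  by rewrite /cm exprSr mulrAC.
apply: eq_integral => s _; congr (F (_ * _)%R * _)%E.
by rewrite /coord_norm big_ord_recl sqr_sqrtr// sumr_ge0// => i _; exact: sqr_ge0.
Qed.

End lebesgueRn_recursion.

(** * Convergence of the Gamma integral *)

Section gamma.
Context {R : realType}.
Local Notation mu := (@lebesgue_measure R).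
Local Notation Q := (measurableTypeR R).

(** Raise x / b <= exp (x / b) to the power b. *)
Lemma powR_le_expR (b x : R) : 0 < b -> 0 <= x -> x `^ b <= b `^ b * expR x.
Proof.
move=> b0 x0.
have -> : x = b * (x / b) by field; rewrite gt_eqF.
have xb0 : 0 <= x / b by rewrite divr_ge0// ltW.
rewrite powRM//; last exact: ltW.
rewrite ler_pM2l ?powR_gt0// [X in expR X]mulrC expRM.
have le1 : x / b <= expR (x / b).
  by apply: (le_trans _ (expR_ge1Dx _)); rewrite lerDr.
by apply: ge0_ler_powR => //; rewrite ?nnegrE ?expR_ge0// ltW.
Qed.

(** The indicator cannot be dropped, since [powR] is 1 on negative bases. A
    function on the whole line is what Tonelli's theorem and affine substitution
    take. *)
Definition gamma_fun (s l t : R) : R :=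
  \1_(`]0, +oo[%classic : set R) t * (t `^ (s - 1) * expR (- (l * t))).

Lemma gamma_fun_ge0 s l t : 0 <= gamma_fun s l t.
Proof. by rewrite /gamma_fun !mulr_ge0// ?powR_ge0 ?expR_ge0. Qed.

Lemma gamma_funE s l t : 0 < t -> gamma_fun s l t = t `^ (s - 1) * expR (- (l * t)).
Proof. by move=> t0; rewrite /gamma_fun indicE mem_set ?mul1r//= in_itv/= t0. Qed.

Lemma gamma_fun0 s l t : t <= 0 -> gamma_fun s l t = 0.
Proof.
by move=> t0; rewrite /gamma_fun indicE memNset ?mul0r//= in_itv/= andbT ltNge t0.
Qed.

Lemma measurable_gamma_fun s l : measurable_fun setT (gamma_fun s l : Q -> Q).
Proof.
apply: measurable_funM; first by apply: measurable_indic; exact: measurable_itv.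
apply: measurable_funM; first exact: measurable_powR.
by mfun.
Qed.

(** The function f is the derivative of F, which takes values between -1 and 0;
    f behaves like t^(s-1) near 0 and is bounded below by a negative power of t at
    infinity, so that it dominates the integrand of Gamma up to a constant. *)
Let F (s t : R) : R := - (1 + t `^ s)^-1.
Let f (s t : R) : R := s * t `^ (s - 1) * ((1 + t `^ s)^-1) ^+ 2.

Let is_derive_F (s t : R) : 0 < t -> is_derive t 1 (F s) (f s t).
Proof.
move=> t0.
have D0 : 1 + t `^ s != 0 by rewrite gt_eqF// ltr_pwDl// powR_ge0.
have h := is_derive1_powR s t0.
have h2 : is_derive t 1 (fun u : R => 1 + u `^ s) (s * t `^ (s - 1)).
  by rewrite -[X in is_derive _ _ _ X]add0r; apply: is_deriveD.
have h3 := is_deriveN (@is_deriveV _ (fun u : R => 1 + u `^ s) t _ 1 D0 h2).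
apply: (is_derive_eq h3).
by rewrite scaleNr opprK /f /GRing.scale/= exprVn mulrC.
Qed.

Let continuous_f (s t : R) : 0 < t -> {for t, continuous (f s)}.
Proof.
move=> t0; have [dF _] := is_derive_F s t0.
have cF : {for t, continuous (F s)}.
  exact/differentiable_continuous/derivable1_diffP.
have cp : {for t, continuous (fun u : R => u `^ (s - 1))}.
  apply/differentiable_continuous/derivable1_diffP.
  by have [] := is_derive1_powR (s - 1) t0.
have cFF : {for t, continuous (fun u : R => F s u * F s u)} by exact: continuousM.
have -> : f s = (fun u : R => s * u `^ (s - 1) * (F s u * F s u)).
  by apply/funext => u; rewrite /f /F mulrNN expr2.
apply: (@continuousM _ _ (fun u : R => s * u `^ (s - 1)) (fun u : R => F s u * F s u)) => //.
by apply: (@continuousM _ _ (fun u : R => s) (fun u : R => u `^ (s - 1))) => //; exact: cvg_cst.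
Qed.

Let integral_f_le1 (s a b : R) : 0 < a -> a < b ->
  (\int[mu]_(t in `[a, b]) (f s t)%:E <= 1)%E.
Proof.
move=> a0 ab.
have dF t : a <= t -> derivable (F s) t 1.
  by move=> at_; have [] := is_derive_F s (lt_le_trans a0 at_).
have cF t : a <= t -> {for t, continuous (F s)}.
  by move=> /dF/derivable1_diffP/differentiable_continuous.
rewrite (@continuous_FTC2 _ _ (F s))//.
- rewrite -EFinB lee_fin /F opprK addrC.
  rewrite (@le_trans _ _ ((1 + a `^ s)^-1))//.
    by rewrite gerDl oppr_le0 invr_ge0 addr_ge0// powR_ge0.
  by rewrite invf_le1 ?lerDl ?powR_ge0// ltr_pwDl// powR_ge0.
- apply: continuous_in_subspaceT => t; rewrite inE/= in_itv/= => /andP[at_ _].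
  by apply: continuous_f; exact: lt_le_trans at_.
- split.
  + by move=> t; rewrite in_itv/= => /andP[at_ _]; apply: dF; exact: ltW.
  + by apply: cvg_at_right_filter; exact: cF.
  + by apply: cvg_at_left_filter; apply: cF; exact: ltW.
- move=> t; rewrite in_itv/= => /andP[at_ _].
  by rewrite derive1E; have [_ ->] := is_derive_F s (lt_trans a0 at_).
Qed.

(** Compare with f, whose integral over any compact interval of positive reals
    is at most 1. *)
Lemma integral_gamma_fun_lty (s : R) : 0 < s ->
  (\int[mu]_t (gamma_fun s 1 t)%:E < +oo)%E.
Proof.
move=> s0.
pose C := (1 + 2 `^ s * s `^ s) ^+ 2 / s.
have fle t : 0 < t -> gamma_fun s 1 t <= C * f s t.
  move=> t0; rewrite gamma_funE// mul1r /C /f.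
  rewrite [leRHS](_ : _ = t `^ (s - 1) * ((1 + 2 `^ s * s `^ s) ^+ 2 * (1 + t `^ s)^-1 ^+ 2)); last first.
    by field; rewrite !gt_eqF// ltr_pwDl// powR_ge0.
  rewrite ler_wpM2l ?powR_ge0// -exprMn.
  rewrite [in leLHS](_ : - t = 2%:R * (- (t / 2))); last by field.
  rewrite expRM_natl; apply: lerXn2r.
  - by rewrite nnegrE expR_ge0.
  - by rewrite nnegrE mulr_ge0// ?invr_ge0 ?addr_ge0// ?mulr_ge0// powR_ge0.
  rewrite ler_pdivlMr ?ltr_pwDl// ?powR_ge0// mulrDr mulr1 lerD//.
    by rewrite expR_le1 oppr_le0 divr_ge0// ltW.
  have t20 : 0 <= t / 2 by rewrite divr_ge0// ltW.
  have -> : t `^ s = 2 `^ s * (t / 2) `^ s.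
    by rewrite -powRM//; congr (_ `^ _); field.
  rewrite mulrCA ler_wpM2l ?powR_ge0// mulrC.
  by rewrite expRN ler_pdivrMr ?expR_gt0// powR_le_expR.
(* These intervals increase to the positive half-line. *)
pose A (k : nat) : set R := `[k.+1%:R^-1, k.+2%:R]%classic.
have UA : \bigcup_k A k = `]0, +oo[%classic.
  apply/seteqP; split => t /=.
    move=> [k _]; rewrite /A/= !in_itv/= andbT => /andP[+ _].
    by apply: lt_le_trans; rewrite invr_gt0.
  rewrite in_itv/= andbT => t0.
  pose k := maxn (Num.truncn t) (Num.truncn t^-1).
  exists k => //; rewrite /A/= in_itv/=; apply/andP; split.
    rewrite invf_ple ?posrE//; apply: ltW; apply: lt_le_trans (truncnS_gt _) _.
    by rewrite ler_nat ltnS leq_maxr.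
  apply: ltW; apply: lt_le_trans (truncnS_gt _) _.
  by rewrite ler_nat ltnS; apply: leq_trans (leqnSn _); exact: leq_maxl.
have mg := measurable_gamma_fun s 1.
have mA k : measurable (A k) by exact: measurable_itv.
have -> : (\int[mu]_t (gamma_fun s 1 t)%:E = \int[mu]_(t in \bigcup_k A k) (gamma_fun s 1 t)%:E)%E.
  rewrite UA [RHS]integral_mkcond; apply: eq_integral => t _.
  rewrite patchE; case: ifPn => //; rewrite notin_setE/= in_itv/= andbT => /negP.
  by rewrite -leNgt => /gamma_fun0 ->.
have ndA : nondecreasing_seq A.
  move=> i j ij; apply/subsetPset => t; rewrite /A/= !in_itv/= => /andP[it ti].
  rewrite (le_trans _ it)/=; last by rewrite lef_pV2 ?posrE// ler_nat.
  by rewrite (le_trans ti)// ler_nat.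
have cv : (\int[mu]_(t in A i) (gamma_fun s 1 t)%:E @[i --> \oo] -->
     \int[mu]_(t in \bigcup_i A i) (gamma_fun s 1 t)%:E)%E.
  apply: ge0_nondecreasing_set_cvg_integral => //.
  - by move=> i; apply/measurable_EFinP; exact: measurable_funTS.
  - by move=> i t _; rewrite lee_fin gamma_fun_ge0.
apply: (@le_lt_trans _ _ C%:E); last exact: ltry.
rewrite -(cvg_lim _ cv)//; apply: lime_le; first by apply/cvg_ex; eexists; exact: cv.
apply: nearW => k.
have C0 : 0 <= C by rewrite divr_ge0 ?sqr_ge0// ltW.
have mf : measurable_fun (A k) (f s).
  apply: measurable_funM.
    by apply: measurable_funM => //; apply: measurable_funTS; exact: measurable_powR.
  apply: measurable_funX.
  have -> : (fun x : R => (1 + x `^ s)^-1) = (fun x => (1 + x `^ s) `^ (-1)).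
    by apply/funext => x; rewrite powR_inv1// addr_ge0// powR_ge0.
  apply: measurable_funTS.
  by mfun; exact: measurable_powR.
have Agt0 t : A k t -> 0 < t.
  by rewrite /A/= in_itv/= => /andP[+ _]; apply: lt_le_trans; rewrite invr_gt0.
have f0 t : A k t -> 0 <= f s t.
  by move=> /Agt0 t0; rewrite /f mulr_ge0 ?sqr_ge0// mulr_ge0 ?powR_ge0// ltW.
apply: (@le_trans _ _ (\int[mu]_(t in A k) (C%:E * (f s t)%:E)))%E.
  apply: ge0_le_integral => //.
  - exact: mA.
  - by move=> t _; rewrite lee_fin gamma_fun_ge0.
  - by apply/measurable_EFinP; exact: measurable_funTS.
  - by apply: emeasurable_funM => //; exact/measurable_EFinP.
  - by move=> t /Agt0 t0; rewrite -EFinM lee_fin fle.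
rewrite ge0_integralZl//; last 2 first.
- exact: mA.
- exact/measurable_EFinP.
rewrite -[leRHS]mule1 lee_wpmul2l// integral_f_le1// ?invr_gt0//.
by rewrite (@le_lt_trans _ _ 1) ?invf_le1 ?ler1n// ltr1n.
Qed.

End gamma.

(** * Integrals of powers of the distance *)

Section gamma_rate.
Context {R : realType}.
Local Notation mu := (@lebesgue_measure R).
Local Notation Q := (measurableTypeR R).
Implicit Types s l h b : R.

Lemma integral_gamma_fun1 s : 0 < s -> (\int[mu]_t (gamma_fun s 1 t)%:E)%E = (Gamma s)%:E.
Proof.
move=> s0; rewrite /Gamma /Rintegral integral_mkcond.
have e : (\int[mu]_t ((fun t : R => (t `^ (s - 1) * expR (- t))%:E) \_ `]0%R, +oo[) t
    = \int[mu]_t (gamma_fun s 1 t)%:E)%E.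
  apply: eq_integral => t _; rewrite patchE.
  case: ifPn; rewrite ?inE ?notin_setE/= in_itv/= andbT.
    by move=> t0; rewrite gamma_funE// mul1r.
  by move=> /negP; rewrite -leNgt => /gamma_fun0 ->.
rewrite e fineK// ge0_fin_numE ?integral_gamma_fun_lty//.
by apply: integral_ge0 => t _; rewrite lee_fin gamma_fun_ge0.
Qed.

(** On [1, 2] the integrand is bounded below by a positive constant. *)
Lemma Gamma_gt0 s : 0 < s -> 0 < Gamma s.
Proof.
move=> s0; rewrite -lte_fin -integral_gamma_fun1//.
(* For 1 <= t <= 2 one has 0 <= ln t <= 1, whence t^(s-1) >= exp (- |s - 1|). *)
pose c := expR (- (`|s - 1| + 2)).
have mg := measurable_gamma_fun s 1.
apply: (@lt_le_trans _ _ (\int[mu]_(t in `[1%R, 2%R]) (c%:E))%E).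
  rewrite integral_cst//= lebesgue_measure_itv/= lte_fin ltr1n -EFinB -EFinM lte_fin.
  by rewrite mulr_gt0 ?expR_gt0// subr_gt0 ltr1n.
apply: (@le_trans _ _ (\int[mu]_(t in `[1%R, 2%R]) (gamma_fun s 1 t)%:E)%E).
  apply: ge0_le_integral => //.
  - by move=> t _; rewrite lee_fin expR_ge0.
  - by apply/measurable_EFinP; exact: measurable_funTS.
  - move=> t /=; rewrite in_itv/= => /andP[t1 t2]; have t0 : 0 < t by exact: lt_le_trans t1.
    rewrite lee_fin gamma_funE// /powR gt_eqF// -expRD ler_expR mul1r opprD lerD//.
      rewrite -normrN lerNl -mulNr.
      apply: (le_trans (ler_norm _)); rewrite normrM -[leRHS]mulr1 ler_wpM2l//.
      rewrite ger0_norm ?ln_ge0//.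
      have : 1 + (t - 1) <= expR 1.
        by apply: (le_trans (expR_ge1Dx _)); rewrite ler_expR; lra.
      by rewrite addrC subrK -{1}(lnK t0) ler_expR.
    by rewrite lerN2.
apply: ge0_subset_integral => //.
- by apply/measurable_EFinP.
- by move=> t _; rewrite lee_fin gamma_fun_ge0.
Qed.

Lemma integral_gamma_fun s l : 0 < s -> 0 < l ->
  (\int[mu]_t (gamma_fun s l t)%:E)%E = (Gamma s * l `^ (- s))%:E.
Proof.
move=> s0 l0.
have mg := measurable_gamma_fun s 1.
have h : (\int[mu]_t (gamma_fun s 1 (l * t + 0)%R)%:E =
    (l `^ (s - 1))%:E * \int[mu]_t (gamma_fun s l t)%:E)%E.
  rewrite -ge0_integralZl//; last 3 first.
  - by apply/measurable_EFinP; exact: measurable_gamma_fun.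
  - by move=> t _; rewrite lee_fin gamma_fun_ge0.
  - by rewrite lee_fin powR_ge0.
  apply: eq_integral => t _; rewrite addr0 -EFinM; congr (_%:E).
  have [t0|t0] := leP t 0.
    by rewrite !gamma_fun0 ?mulr0// pmulr_rle0.
  rewrite !gamma_funE// ?mulr_gt0// mul1r powRM ?mulrA//; exact: ltW.
have := @ge0_integral_affine R l 0 (fun t => (gamma_fun s 1 t)%:E) (lt0r_neq0 l0).
rewrite h integral_gamma_fun1// gtr0_norm// muleA -EFinM => /(_ _ _).
rewrite mulr_powRB1 ?ltW// => e.
rewrite mulrC EFinM -e; last 2 first.
- exact/measurable_EFinP.
- by move=> t; rewrite lee_fin gamma_fun_ge0.
rewrite muleA -EFinM -powRD; last by rewrite (gt_eqF l0) implybT.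
by rewrite [- s + s]addrC subrr powRr0 mul1e.
Qed.

Lemma integral_gauss_sqdist m (a : nat -> R) (kappa : R) : 0 < kappa ->
  (\int[lebesgueRn R m]_y (expR (- (kappa ^+ 2 * sqdist a y)))%:E)%E =
  ((Num.sqrt pi / kappa) ^+ m)%:E.
Proof.
move=> k0.
have := @integral_gauss_linform R m (fun=> 0) a kappa (fun=> 1%E) k0.
move=> /(_ (measurable_cst _) (fun=> lee01)).
under eq_integral do rewrite mul1e.
move=> ->; under eq_integral do rewrite mul1e.
rewrite integral_gauss_scale// -EFinM -mulrA; congr (_%:E).
rewrite [X in _ * X](_ : _ = 1) ?mulr1//.
by field; rewrite !gt_eqF// sqrtr_gt0 pi_gt0.
Qed.

(** Gamma(b) D^-b is the integral of t^(b-1) exp(-t D) over t > 0. Exchanging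
    the integrals leaves a Gaussian in y, of total mass (pi / t)^(m/2), which
    lowers the exponent of t by m / 2. *)
Lemma integral_powR_sqdist m (a : nat -> R) h b : 0 < h -> m%:R / 2 < b ->
  (\int[lebesgueRn R m]_y ((h ^+ 2 + sqdist a y) `^ (- b))%:E)%E =
  (pi `^ (m%:R / 2) * h `^ (m%:R - 2 * b) * (Gamma (b - m%:R / 2) / Gamma b))%:E.
Proof.
move=> h0 bm.
have b0 : 0 < b by apply: le_lt_trans bm; rewrite divr_ge0.
have bm0 : 0 < b - m%:R / 2 by rewrite subr_gt0.
have Gb0 := Gamma_gt0 b0.
have h20 : 0 < h ^+ 2 by rewrite exprn_gt0.
have D0 (y : m.-tuple Q) : 0 < h ^+ 2 + sqdist a y.
  by rewrite ltr_pwDl// sqdist_ge0.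
pose H (z : (m.-tuple Q) * Q) : \bar R := (gamma_fun b (h ^+ 2 + sqdist a z.1) z.2)%:E.
have mH : measurable_fun setT H.
  apply/measurable_EFinP; apply: measurable_funM.
    apply: (measurableT_comp _ measurable_snd).
    by apply: measurable_indic; exact: measurable_itv.
  apply: measurable_funM.
    exact: (measurableT_comp (measurable_powR _) measurable_snd).
  mfun.
  exact: (measurableT_comp (measurable_sqdist a) measurable_fst).
have e1 : (\int[lebesgueRn R m]_y \int[mu]_t H (y, t) = (Gamma b)%:E *
    \int[lebesgueRn R m]_y ((h ^+ 2 + sqdist a y) `^ (- b))%:E)%E.
  rewrite -ge0_integralZl//; last 3 first.
  - apply/measurable_EFinP; mfun; exact: measurable_sqdist.
  - by move=> y _; rewrite lee_fin powR_ge0.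
  - by rewrite lee_fin ltW.
  by apply: eq_integral => y _; rewrite /H/= integral_gamma_fun// EFinM.
have e2 : (\int[mu]_t \int[lebesgueRn R m]_y H (y, t) =
    (pi `^ (m%:R / 2))%:E * (Gamma (b - m%:R / 2) * (h ^+ 2) `^ (- (b - m%:R / 2)))%:E)%E.
  rewrite -integral_gamma_fun// -ge0_integralZl//; last 3 first.
  - by apply/measurable_EFinP; exact: measurable_gamma_fun.
  - by move=> t _; rewrite lee_fin gamma_fun_ge0.
  - by rewrite lee_fin powR_ge0.
  apply: eq_integral => t _; rewrite /H/=.
  have [t0|t0] := leP t 0.
    under eq_integral do rewrite gamma_fun0//.
    by rewrite integral0 gamma_fun0// mule0.
  pose k := Num.sqrt t.
  have k0 : 0 < k by rewrite sqrtr_gt0.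
  have k2 : k ^+ 2 = t by rewrite sqr_sqrtr// ltW.
  transitivity (\int[lebesgueRn R m]_y ((gamma_fun b (h ^+ 2) t)%:E *
     (expR (- (k ^+ 2 * sqdist a y)))%:E))%E.
    apply: eq_integral => y _; rewrite !gamma_funE// k2 -EFinM; congr (_%:E).
    by rewrite mulrDl opprD expRD mulrA [sqdist _ _ * t]mulrC.
  rewrite ge0_integralZl//; last 2 first.
  - by apply/measurable_EFinP; mfun; exact: measurable_sqdist.
  - by rewrite lee_fin gamma_fun_ge0.
  rewrite integral_gauss_sqdist// -!EFinM; congr (_%:E).
  have sqrtX (u : R) : 0 <= u -> Num.sqrt u ^+ m = u `^ (m%:R / 2).
    by move=> u0; rewrite -powR_mulrn ?sqrtr_ge0// -powR12_sqrt// -powRrM mulrC.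
  rewrite !gamma_funE// expr_div_n /k sqrtX ?pi_ge0// sqrtX ?(ltW t0)//.
  rewrite (_ : b - m%:R / 2 - 1 = (b - 1) + (- (m%:R / 2))); last by ring.
  rewrite (@powRD _ t (b - 1) (- (m%:R / 2))); last by rewrite (gt_eqF t0) implybT.
  by rewrite powRN; ring.
have := fubini_tonelli (m1 := lebesgueRn R m) (m2 := mu) H mH.
rewrite e1 e2 => /(_ _) E.
have {}E : ((Gamma b)%:E * \int[lebesgueRn R m]_y ((h ^+ 2 + sqdist a y) `^ (- b))%:E =
  (pi `^ (m%:R / 2))%:E * (Gamma (b - m%:R / 2) * (h ^+ 2) `^ (- (b - m%:R / 2)))%:E)%E.
  by apply: E => z; rewrite lee_fin gamma_fun_ge0.
have -> : (\int[lebesgueRn R m]_y ((h ^+ 2 + sqdist a y) `^ (- b))%:E =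
   (Gamma b)^-1%:E * ((Gamma b)%:E * \int[lebesgueRn R m]_y ((h ^+ 2 + sqdist a y) `^ (- b))%:E))%E.
  by rewrite muleA -EFinM mulVf ?gt_eqF// mul1e.
rewrite E -!EFinM; congr (_%:E).
rewrite -powR_mulrn ?ltW// -powRrM.
rewrite (_ : 2%:R * - (b - m%:R / 2) = m%:R - 2 * b); last by field.
by field; rewrite gt_eqF.
Qed.

End gamma_rate.

(** * Rotation invariance of homogeneous kernels *)

Lemma measurable_norm_powR (R : realType) (b : R) d (T : measurableType d)
  (g : T -> R) :
  measurable_fun setT g -> measurable_fun setT (fun x => `|g x| `^ b).
Proof.
move=> mg; apply: (measurableT_comp (measurable_powR b)).
exact: measurableT_comp.
Qed.

Section gauss_moment.
Context {R : realType}.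
Local Notation mu := (@lebesgue_measure R).
Local Notation Q := (measurableTypeR R).

(** The normalizing constant that turns powers of A into integrals of
    exp(-t^2 A); see [gauss_moment_rate]. *)
Definition gauss_moment (b : R) : \bar R :=
  (\int[mu]_t (`|t| `^ b * expR (- t ^+ 2))%:E)%E.

Let measurable_moment b : measurable_fun setT (fun t : Q => (`|t| `^ b * expR (- t ^+ 2))%:E).
Proof.
apply/measurable_EFinP; apply: measurable_funM; first exact: measurable_norm_powR.
by mfun.
Qed.

Lemma gauss_moment_lty b : 0 < b -> (gauss_moment b < +oo)%E.
Proof.
move=> b0.
(* With u = t^2 / 2, |t|^b exp(-u) is 2^(b/2) u^(b/2) exp(-u), hence at most C. *)
pose C := 2 `^ (b / 2) * (b / 2) `^ (b / 2).
have C0 : 0 <= C by rewrite mulr_ge0// powR_ge0.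
pose k := Num.sqrt (2^-1 : R).
have k0 : 0 < k by rewrite sqrtr_gt0 invr_gt0.
have k2 : k ^+ 2 = 2^-1 by rewrite sqr_sqrtr.
apply: (@le_lt_trans _ _ (\int[mu]_t (C%:E * (expR (- (k * t) ^+ 2))%:E))%E).
  apply: ge0_le_integral => //.
  - by apply: emeasurable_funM => //; mfun.
  - move=> t _; rewrite -EFinM lee_fin exprMn k2.
    have -> : `|t| `^ b = 2 `^ (b / 2) * (t ^+ 2 / 2) `^ (b / 2).
      rewrite -powRM ?divr_ge0 ?sqr_ge0// mulrC divfK//.
      by rewrite -real_normK ?num_real// -powR_mulrn// -powRrM; congr (_ `^ _); field.
    rewrite /C -[leRHS]mulrA -[leLHS]mulrA ler_wpM2l ?powR_ge0//.
    rewrite [in leLHS](_ : - t ^+ 2 = - (t ^+ 2 / 2) + (- (2^-1 * t ^+ 2))); last by field.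
    rewrite expRD mulrA ler_wpM2r ?expR_ge0// expRN ler_pdivrMr ?expR_gt0//.
    by rewrite powR_le_expR ?divr_ge0 ?sqr_ge0// divr_gt0.
rewrite ge0_integralZl//; last by mfun.
by rewrite integral_gauss_scale// -EFinM ltry.
Qed.

Lemma gauss_moment_gt0 b : 0 < b -> (0 < gauss_moment b)%E.
Proof.
move=> b0; pose c : R := expR (- 4).
apply: (@lt_le_trans _ _ (\int[mu]_(t in `[1%R, 2%R]) (c%:E))%E).
  rewrite integral_cst//= lebesgue_measure_itv/= lte_fin ltr1n -EFinB -EFinM lte_fin.
  by rewrite mulr_gt0 ?expR_gt0// subr_gt0 ltr1n.
apply: (@le_trans _ _ (\int[mu]_(t in `[1%R, 2%R]) (`|t| `^ b * expR (- t ^+ 2))%:E)%E).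
  apply: ge0_le_integral => //.
  - by move=> t _; rewrite lee_fin expR_ge0.
  - exact: measurable_funTS.
  - move=> t /=; rewrite in_itv/= => /andP[t1 t2]; have t0 : 0 < t by exact: lt_le_trans t1.
    rewrite lee_fin /c -[leLHS]mul1r ler_pM ?expR_ge0//.
      rewrite gtr0_norm// -(powRr0 t) ler_powR// ltW//.
    by rewrite ler_expR lerN2; nra.
apply: ge0_subset_integral => //.
Qed.

Lemma gauss_moment_rate b A : 0 < A ->
  (\int[mu]_t (`|t| `^ b * expR (- (t ^+ 2 * A)))%:E =
   gauss_moment b * (A `^ (- ((b + 1) / 2)))%:E)%E.
Proof.
move=> A0; pose k := Num.sqrt A.
have k0 : 0 < k by rewrite sqrtr_gt0.
have k2 : k ^+ 2 = A by rewrite sqr_sqrtr// ltW.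
have f0 (t : Q) : (0 <= (`|t| `^ b * expR (- t ^+ 2))%:E)%E.
  by rewrite lee_fin mulr_ge0 ?powR_ge0 ?expR_ge0.
have := ge0_integral_affine 0 (lt0r_neq0 k0) (measurable_moment b) f0.
rewrite /gauss_moment => <-.
rewrite gtr0_norm// muleC muleA -EFinM -ge0_integralZl//; last 2 first.
- exact: (measurableT_comp (measurable_moment b) (measurable_affine k 0)).
- by rewrite lee_fin mulr_ge0 ?powR_ge0// ltW.
apply: eq_integral => t _; rewrite !addr0 -EFinM; congr (_%:E).
rewrite normrM powRM// (gtr0_norm k0) exprMn k2 (mulrC A).
have E : A `^ (- ((b + 1) / 2)) * k * k `^ b = 1.
  have -> : A `^ (- ((b + 1) / 2)) = k `^ (- (b + 1)).
    by rewrite /k -powR12_sqrt ?(ltW A0)// -powRrM; congr (_ `^ _); field.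
  rewrite -{2}(powRr1 (ltW k0)) -!powRD ?(gt_eqF k0) ?implybT//.
  by rewrite (_ : _ + _ = 0) ?powRr0//; ring.
by rewrite [RHS]mulrA [X in _ = X * _]mulrA E mul1r.
Qed.

End gauss_moment.

Section ray_integral.
Context {R : realType}.
Local Notation mu := (@lebesgue_measure R).
Local Notation Q := (measurableTypeR R).

(** For the substitution that scales y by t, which fails at t = 0 only. *)
Lemma eq_ge0_integral_except0 (f g : Q -> \bar R) :
  measurable_fun setT f -> measurable_fun setT g ->
  (forall t, 0 <= f t)%E -> (forall t, 0 <= g t)%E ->
  (forall t, t != 0 -> f t = g t) -> (\int[mu]_t f t = \int[mu]_t g t)%E.
Proof.
move=> mf mg f0 g0 fg; apply: ge0_ae_eq_integral => //.
exists [set 0]; split.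
- exact: measurable_set1.
- exact: lebesgue_measure_set1.
- move=> t /=; apply: contra_notP => /eqP t0 _; exact: fg.
Qed.

Lemma mule_pcancel (c x y : \bar R) : (0 < c)%E -> (c < +oo)%E ->
  (c * x = c * y)%E -> x = y.
Proof.
case: c => // c; rewrite lte_fin => c0 _ e.
have h u : (c^-1%:E * (c%:E * u) = u)%E.
  by rewrite muleA -EFinM mulVf ?gt_eqF// mul1e.
by rewrite -(h x) e h.
Qed.

Variables (m : nat) (a : nat -> R) (h r : R).
Hypotheses (h0 : 0 < h) (r0 : 0 < r).

(** Up to a power of h this is the integral of |omega . v|^r over the hemisphere
    of directions omega from the point at height h above [a] to the hyperplane,
    where v = (z, zn): central projection contributes the factor
    h / dist^(m+1). *)
Definition ray_integral (z : nat -> R) (zn : R) : \bar R :=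
  (\int[lebesgueRn R m]_y (`|linform z a y - h * zn| `^ r *
     (h ^+ 2 + sqdist a y) `^ (- ((r + m%:R + 1) / 2)))%:E)%E.

(** Write the power of the squared distance as an integral over t, exchange the
    integrals, and scale y by t: the pair (t h, t y) is then a Gaussian vector in
    R x R^m, and the integrand depends on one linear form of it. *)
Lemma gauss_moment_ray_integral (z : nat -> R) (zn : R) :
  (gauss_moment (r + m%:R) * ray_integral z zn =
   (Num.sqrt pi ^+ m / h)%:E *
     \int[mu]_s (`|Num.sqrt ((- zn) ^+ 2 + coord_norm m z ^+ 2) * s| `^ r * expR (- s ^+ 2))%:E)%E.
Proof.
set rho := coord_norm m z.
have spi0 : 0 < Num.sqrt (pi : R) by rewrite sqrtr_gt0 pi_gt0.
have D0 (y : m.-tuple Q) : 0 < h ^+ 2 + sqdist a y.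
  by rewrite ltr_pwDl ?sqdist_ge0// exprn_gt0.
have rm0 : 0 < r + m%:R by rewrite ltr_pwDl.
pose L (y : m.-tuple Q) := linform z a y - h * zn.
have mL : measurable_fun setT L.
  by apply: measurable_funB => //; exact: measurable_linform.
pose H (x : (m.-tuple Q) * Q) : \bar R :=
  ((`|L x.1| `^ r * `|x.2| `^ (r + m%:R))
   * expR (- (x.2 ^+ 2 * (h ^+ 2 + sqdist a x.1))))%:E.
have mH : measurable_fun setT H.
  apply/measurable_EFinP; apply: measurable_funM.
    apply: measurable_funM; apply: measurable_norm_powR => //.
    exact: (measurableT_comp mL measurable_fst).
  by mfun; exact: (measurableT_comp (measurable_sqdist a) measurable_fst).
have H0 x : (0 <= H x)%E by rewrite lee_fin !mulr_ge0 ?powR_ge0 ?expR_ge0.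
have e1 : (\int[lebesgueRn R m]_y \int[mu]_t H (y, t) =
    gauss_moment (r + m%:R) * ray_integral z zn)%E.
  rewrite /ray_integral -ge0_integralZl//; last 3 first.
  - apply/measurable_EFinP; apply: measurable_funM; first exact: measurable_norm_powR.
    by mfun; exact: measurable_sqdist.
  - by move=> y _; rewrite lee_fin mulr_ge0 ?powR_ge0.
  - by rewrite ltW// gauss_moment_gt0.
  apply: eq_integral => y _.
  rewrite EFinM muleCA -gauss_moment_rate// -ge0_integralZ.
  - by apply: eq_integral => t _; rewrite -EFinM mulrA.
  - exact: powR_ge0.
  - apply/measurable_EFinP; apply: measurable_funM; first exact: measurable_norm_powR.
    by mfun.
  - by move=> t; rewrite lee_fin mulr_ge0 ?powR_ge0 ?expR_ge0.
pose G (x : Q * Q) : \bar R :=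
  (`|- zn * x.1 + rho * x.2| `^ r * expR (- ((1 * x.1) ^+ 2 + (1 * x.2) ^+ 2)))%:E.
have mG : measurable_fun setT G.
  apply/measurable_EFinP; apply: measurable_funM; last by mfun.
  by apply: measurable_norm_powR; mfun.
have G0 x : (0 <= G x)%E by rewrite lee_fin mulr_ge0 ?powR_ge0 ?expR_ge0.
pose g t := (\int[mu]_s G (t, s))%E.
have mg : measurable_fun setT g by exact: (measurable_fun_fubini_tonelli_F _ mG G0).
have g0 t : (0 <= g t)%E by apply: integral_ge0 => s _.
pose c : R := Num.sqrt pi ^+ m / Num.sqrt pi.
have c0 : 0 <= c by rewrite divr_ge0 ?exprn_ge0 ?sqrtr_ge0.
have e2 : (\int[mu]_t \int[lebesgueRn R m]_y H (y, t) =
    \int[mu]_t (c%:E * g (h * t + 0)%R))%E.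
  apply: eq_ge0_integral_except0.
  - exact: (measurable_fun_fubini_tonelli_G _ mH H0).
  - apply: emeasurable_funM; first exact: measurable_cst.
    exact: (measurableT_comp mg (measurable_affine h 0)).
  - by move=> t; apply: integral_ge0.
  - by move=> t; rewrite mule_ge0.
  move=> t t0; pose k := `|t|.
  have k0 : 0 < k by rewrite normr_gt0.
  have k2 : k ^+ 2 = t ^+ 2 by rewrite real_normK ?num_real.
  pose F (u : Q) : \bar R := (`|t * u - t * (h * zn)| `^ r)%:E.
  have mF : measurable_fun setT F.
    by apply/measurable_EFinP; apply: measurable_norm_powR; mfun.
  have F0 u : (0 <= F u)%E by rewrite lee_fin powR_ge0.
  pose B := k ^+ m * expR (- (t ^+ 2 * h ^+ 2)).
  have B0 : 0 <= B by rewrite mulr_ge0 ?expR_ge0// exprn_ge0// ltW.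
  transitivity (\int[lebesgueRn R m]_y (B%:E *
      (F (linform z a y) * (expR (- (k ^+ 2 * sqdist a y)))%:E)))%E.
    apply: eq_integral => y _; rewrite /H/= /F -!EFinM; congr (_%:E).
    rewrite -mulrBr normrM powRM//.
    rewrite powRD; last by rewrite (gt_eqF rm0).
    rewrite powR_mulrn// -/k k2 mulrDr opprD expRD /B -/(L y); ring.
  rewrite ge0_integralZ//; last 2 first.
  - apply: emeasurable_funM.
      exact: (measurableT_comp mF (measurable_linform _ _)).
    by mfun; exact: measurable_sqdist.
  - by move=> y; rewrite mule_ge0// lee_fin expR_ge0.
  rewrite integral_gauss_linform// -/rho.
  pose f (u : Q) : \bar R := (`|rho * u - t * (h * zn)| `^ r * expR (- u ^+ 2))%:E.
  have mf : measurable_fun setT f.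
    by apply/measurable_EFinP; apply: measurable_funM;
      [apply: measurable_norm_powR; mfun|mfun].
  have f0 u : (0 <= f u)%E by rewrite lee_fin mulr_ge0 ?powR_ge0 ?expR_ge0.
  have -> : g (h * t + 0)%R = ((expR (- (t ^+ 2 * h ^+ 2)))%:E * \int[mu]_u f u)%E.
    rewrite -ge0_integralZ ?expR_ge0//.
    apply: eq_integral => u _; rewrite /G /f/= -EFinM; congr (_%:E).
    rewrite addr0 !mul1r opprD expRD [LHS]mulrCA; congr (expR _ * (_ * _)).
      by ring.
    by congr (`|_| `^ _); ring.
  have -> : (\int[mu]_u f u = k%:E * \int[mu]_s (F (rho * s)%R * (expR (- (k * s) ^+ 2))%:E))%E.
    rewrite -(ge0_integral_affine 0 t0 mf f0); congr (_ * _)%E.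
    apply: eq_integral => s _; rewrite /f /F addr0 -EFinM !exprMn k2.
    by congr ((`|_| `^ _ * _)%:E); ring.
  rewrite !muleA -!EFinM; congr (_%:E * _)%E.
  rewrite /B /c expr_div_n; field.
  by rewrite expf_neq0 ?(gt_eqF k0) ?(gt_eqF spi0).
rewrite -e1 (fubini_tonelli (m1 := lebesgueRn R m) (m2 := mu) H mH H0) e2.
rewrite (ge0_integralZ _ c0 (measurableT_comp mg (measurable_affine h 0)) (fun t => g0 _)).
have e3 : (\int[mu]_t g (h * t + 0)%R = h^-1%:E * \int[mu]_t g t)%E.
  rewrite -(ge0_integral_affine 0 (lt0r_neq0 h0) mg g0) gtr0_norm// muleA -EFinM.
  by rewrite mulVf ?gt_eqF// mul1e.
rewrite e3.
have -> : (\int[mu]_t g t = \int[mu]_t \int[mu]_s ((`|- zn * t + rho * s| `^ r)%:E *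
     (expR (- ((1 * t) ^+ 2 + (1 * s) ^+ 2)))%:E))%E.
  by apply: eq_integral => t _; apply: eq_integral => s _; rewrite -EFinM.
(* The linear form in y has become rho times one Gaussian variable, and it is
   merged with the Gaussian variable t h. *)
rewrite (gauss2_rotate (- zn) rho (F := fun u => (`|u| `^ r)%:E))//; last first.
  by apply/measurable_EFinP; exact: measurable_norm_powR.
rewrite !muleA -!EFinM; congr (_%:E * _)%E.
  by rewrite /c divr1; field; rewrite (gt_eqF h0) (gt_eqF spi0).
by apply: eq_integral => s _; rewrite -EFinM mul1r.
Qed.

(** The previous identity depends on (z, zn) through its norm only, and the
    constant on its left is positive and finite. *)
Lemma ray_integral_rotate (z z' : nat -> R) (zn zn' : R) :
  zn ^+ 2 + \sum_(i < m) z i ^+ 2 = zn' ^+ 2 + \sum_(i < m) z' i ^+ 2 ->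
  ray_integral z zn = ray_integral z' zn'.
Proof.
move=> zz'.
have rm0 : 0 < r + m%:R by rewrite ltr_pwDl.
have g0 := gauss_moment_gt0 rm0.
apply: (mule_pcancel g0 (gauss_moment_lty rm0)).
have nrmE w : coord_norm m w ^+ 2 = \sum_(i < m) w i ^+ 2.
  by rewrite /coord_norm sqr_sqrtr// sumr_ge0// => i _; exact: sqr_ge0.
have e : (- zn) ^+ 2 + coord_norm m z ^+ 2 = (- zn') ^+ 2 + coord_norm m z' ^+ 2.
  by rewrite !sqrrN !nrmE.
have := gauss_moment_ray_integral z zn; rewrite e => ->.
exact/esym/gauss_moment_ray_integral.
Qed.

End ray_integral.

(** * The kernel is extremal in the normal direction *)

(** The q-th power of the L^q norm of the kernel in the normal direction, at
    height 1; its power 1 / q is the constant of the theorem up to |k| beta. *)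
Definition kernel_constant (R : realType) (m : nat) (beta q : R) : R :=
  pi `^ (m%:R / 2) * Gamma ((beta + 2) * q / 2 - m%:R / 2)
    / Gamma ((beta + 2) * q / 2).

Lemma kernel_constant_gt0 (R : realType) (m : nat) (beta q : R) :
  0 < (beta + 2) * q -> m%:R < (beta + 2) * q -> 0 < kernel_constant m beta q.
Proof.
move=> N0 mN; rewrite /kernel_constant !mulr_gt0 ?invr_gt0 ?powR_gt0 ?pi_gt0//.
  by rewrite Gamma_gt0// subr_gt0 ltr_pM2r// invr_gt0.
by rewrite Gamma_gt0// divr_gt0.
Qed.

Section kernel.
Context {R : realType}.
Local Notation Q := (measurableTypeR R).
Variables (m : nat) (a : nat -> R) (h : R).
Hypothesis h0 : 0 < h.
Local Notation D y := (h ^+ 2 + sqdist a y).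

Lemma dist_sq_gt0 (y : m.-tuple Q) : 0 < D y.
Proof. by rewrite ltr_pwDl ?sqdist_ge0// exprn_gt0. Qed.

Lemma measurable_dist_powR (b : R) : measurable_fun setT (fun y : m.-tuple Q => D y `^ b).
Proof. by mfun; exact: measurable_sqdist. Qed.

Lemma measurable_height (z : nat -> R) (zn : R) :
  measurable_fun setT (fun y : m.-tuple Q => linform z a y - h * zn).
Proof. by apply: measurable_funB => //; exact: measurable_linform. Qed.

(** Young's inequality with the conjugate exponents (q + s) / q and (q + s) / s. *)
Lemma young_powR (u v q s : R) : 0 <= u -> 0 <= v -> 0 < q -> 0 < s ->
  u `^ q * v `^ s <= q / (q + s) * u `^ (q + s) + s / (q + s) * v `^ (q + s).
Proof.
move=> u0 v0 q0 s0; have r0 : 0 < q + s by rewrite addr_gt0.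
have := @conjugate_powR R (u `^ q) (v `^ s) ((q + s) / q) ((q + s) / s)
  (powR_ge0 _ _) (powR_ge0 _ _).
rewrite !divr_gt0// => /(_ isT isT).
rewrite !invf_div -mulrDl mulfV ?gt_eqF// => /(_ erefl).
rewrite -!powRrM !(mulrC _ ((q + s) / _)) !divfK ?gt_eqF//.
by rewrite !(mulrC (_ / (q + s))).
Qed.

Lemma measurable_kernel (z : nat -> R) (zn b N : R) :
  measurable_fun setT (fun y : m.-tuple Q =>
    (`|linform z a y - h * zn| `^ b * D y `^ N)%:E).
Proof.
apply/measurable_EFinP; apply: measurable_funM; last exact: measurable_dist_powR.
by apply: measurable_norm_powR; exact: measurable_height.
Qed.

Lemma kernel_ge0 (u b c N : R) : (0 <= (u `^ b * c `^ N)%:E)%E.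
Proof. by rewrite lee_fin mulr_ge0 ?powR_ge0. Qed.

(** Rotate the unit vector (z, zn) to the normal direction (0, 1). *)
Lemma ray_integral_unit (r : R) (z : nat -> R) (zn : R) : 0 < r ->
  zn ^+ 2 + \sum_(i < m) z i ^+ 2 = 1 ->
  ray_integral m a h r z zn =
  (\int[lebesgueRn R m]_y (h `^ r * D y `^ (- ((r + m%:R + 1) / 2)))%:E)%E.
Proof.
move=> r0 zz1.
rewrite (@ray_integral_rotate R m a h r h0 r0 z (fun=> 0) zn 1); last first.
  by rewrite zz1 big1 ?expr1n ?addr0// => i _; rewrite expr0n.
apply: eq_integral => y _; rewrite /linform big1 => [|i _]; last by rewrite mul0r.
by rewrite add0r mulr1 normrN gtr0_norm.
Qed.

(** Multiply by h^s with s = (beta + 1) q - (m + 1), chosen so that Young's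
    inequality leads to the homogeneous kernels of [ray_integral_unit], whose
    integrals in the given and in the normal direction coincide. *)
Lemma kernel_integral_le (q beta : R) (z : nat -> R) (zn : R) :
  0 < q -> 0 < (beta + 1) * q - m.+1%:R ->
  zn ^+ 2 + \sum_(i < m) z i ^+ 2 = 1 ->
  (\int[lebesgueRn R m]_y (`|linform z a y - h * zn| `^ q * D y `^ (- ((beta + 2) * q / 2)))%:E
   <= \int[lebesgueRn R m]_y (h `^ q * D y `^ (- ((beta + 2) * q / 2)))%:E)%E.
Proof.
move=> q0; set s := _ - _ => s0 zz1.
have r0 : 0 < q + s by rewrite addr_gt0.
have hs0 : (0 < (h `^ s)%:E)%E by rewrite lte_fin powR_gt0.
have qr0 : 0 <= q / (q + s) by exact/ltW/divr_gt0.
have sr0 : 0 <= s / (q + s) by exact/ltW/divr_gt0.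
have qrsr : q / (q + s) + s / (q + s) = 1 by rewrite -mulrDl mulfV// gt_eqF.
pose N := (beta + 2) * q / 2; rewrite -/N.
have NE : (q + s + m%:R + 1) / 2 = N.
  by rewrite /N /s -(natr1 m); field.
have := ray_integral_unit r0 zz1; rewrite /ray_integral NE => Kz.
have mL b := measurable_kernel z zn b (- N).
have mh b : measurable_fun setT (fun y : m.-tuple Q => (h `^ b * D y `^ (- N))%:E).
  apply/measurable_EFinP; apply: measurable_funM; last exact: measurable_dist_powR.
  exact: measurable_cst.
have mZ (c : R) (f : m.-tuple Q -> \bar R) : measurable_fun setT f ->
    measurable_fun setT (fun y => (c%:E * f y)%E).
  by move=> mf; apply: emeasurable_funM => //; exact: measurable_cst.
pose IL : \bar R := (\int[lebesgueRn R m]_y (h `^ (q + s) * D y `^ (- N))%:E)%E.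
pose g (y : m.-tuple Q) : \bar R := ((q / (q + s))%:E *
     (`|linform z a y - h * zn| `^ (q + s) * D y `^ (- N))%:E
   + (s / (q + s))%:E * (h `^ (q + s) * D y `^ (- N))%:E)%E.
have gE : (\int[lebesgueRn R m]_y g y = IL)%E.
  rewrite /g ge0_integralD; last 5 first.
  - exact: measurableT.
  - by move=> y _; apply: mule_ge0; [rewrite lee_fin|exact: kernel_ge0].
  - by apply: mZ; exact: mL.
  - by move=> y _; apply: mule_ge0; [rewrite lee_fin|exact: kernel_ge0].
  - by apply: mZ; exact: mh.
  rewrite (ge0_integralZ _ qr0 (mL _) (fun y => kernel_ge0 _ _ _ _)).
  rewrite (ge0_integralZ _ sr0 (mh _) (fun y => kernel_ge0 _ _ _ _)).
  rewrite Kz -ge0_muleDl; [|by rewrite lee_fin|by rewrite lee_fin].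
  by rewrite -EFinD qrsr mul1e.
have hE : ((h `^ s)%:E * \int[lebesgueRn R m]_y (h `^ q * D y `^ (- N))%:E = IL)%E.
  rewrite -(ge0_integralZ _ (powR_ge0 _ _) (mh _) (fun y => kernel_ge0 _ _ _ _)).
  apply: eq_integral => y _.
  rewrite -EFinM mulrA -powRD; last by rewrite (gt_eqF h0) implybT.
  by rewrite (addrC s).
rewrite -(lee_pmul2l (isT : (h `^ s)%:E \is a fin_num) hs0) hE -gE.
rewrite -(ge0_integralZ _ (powR_ge0 _ _) (mL _) (fun y => kernel_ge0 _ _ _ _)).
apply: ge0_le_integral.
- exact: measurableT.
- by move=> y _; apply: mule_ge0; [exact: ltW|exact: kernel_ge0].
- by apply: mZ; exact: mL.
- by apply: emeasurable_funD; apply: mZ.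
move=> y _; rewrite /g -!EFinM -EFinD lee_fin !mulrA -mulrDl.
apply: ler_wpM2r; first exact: powR_ge0.
rewrite mulrC.
exact: young_powR (normr_ge0 _) (ltW h0) q0 s0.
Qed.

Lemma kernel_integralE (q beta : R) : 0 < q -> m%:R < (beta + 2) * q ->
  (\int[lebesgueRn R m]_y (h `^ q * D y `^ (- ((beta + 2) * q / 2)))%:E =
  (kernel_constant m beta q * h `^ (m%:R - (beta + 1) * q))%:E)%E.
Proof.
move=> q0 mq.
under eq_integral => y _ do rewrite EFinM.
rewrite ge0_integralZ ?powR_ge0//; last 2 first.
- by apply/measurable_EFinP; exact: measurable_dist_powR.
- by move=> y; rewrite lee_fin powR_ge0.
rewrite integral_powR_sqdist//; last by rewrite ltr_pM2r// invr_gt0.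
rewrite -EFinM; congr (_%:E).
rewrite (_ : m%:R - (beta + 1) * q = q + (m%:R - 2 * ((beta + 2) * q / 2))); last by field.
rewrite (@powRD _ h q) ?(gt_eqF h0) ?implybT// /kernel_constant; ring.
Qed.

End kernel.

(** * Distances to boundary points *)

Section geometry.
Context {R : realType} {m : nat}.
Local Notation Q := (measurableTypeR R).
Implicit Types (x v : 'rV[R]_m.+1) (y : m.-tuple Q).

Definition coords x : nat -> R := fun i => x 0 (inord i).

Lemma inord_widen (i : 'I_m) : inord i = widen_ord (leqnSn m) i :> 'I_m.+1.
Proof. by apply/val_inj; rewrite /= inordK// ltnS ltnW. Qed.

Lemma bdry_pt_last y : bdry_pt y 0 ord_max = 0.
Proof. by rewrite mxE nth_default// size_tuple. Qed.

Lemma eucl_ge0 d (v : 'rV[R]_d) : 0 <= eucl v.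
Proof. exact: sqrtr_ge0. Qed.

Lemma eucl_sq d (v : 'rV[R]_d) : eucl v ^+ 2 = \sum_(i < d) (v 0 i) ^+ 2.
Proof. by rewrite sqr_sqrtr// sumr_ge0// => i _; exact: sqr_ge0. Qed.

Lemma eucl_bdry x y :
  eucl (bdry_pt y - x) ^+ 2 = last_coord x ^+ 2 + sqdist (coords x) y.
Proof.
rewrite eucl_sq big_ord_recr/= addrC !mxE nth_default ?size_tuple// sub0r sqrrN.
congr (_ + _); apply: eq_bigr => i _.
by rewrite !mxE (tnth_nth 0) /coords inord_widen.
Qed.

Lemma dot_bdry x v y :
  \sum_i v 0 i * (bdry_pt y - x) 0 i =
  linform (coords v) (coords x) y - last_coord x * v 0 ord_max.
Proof.
rewrite big_ord_recr/= !mxE nth_default ?size_tuple// sub0r mulrN mulrC.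
congr (_ - _); apply: eq_bigr => i _.
by rewrite !mxE (tnth_nth 0) /coords inord_widen.
Qed.

Lemma eucl_coords v :
  eucl v ^+ 2 = v 0 ord_max ^+ 2 + \sum_(i < m) coords v i ^+ 2.
Proof.
rewrite eucl_sq big_ord_recr/= addrC; congr (_ + _).
by apply: eq_bigr => i _; rewrite /coords inord_widen.
Qed.

Lemma le_coord_eucl d (v : 'rV[R]_d) i : `|v 0 i| <= eucl v.
Proof.
rewrite -sqrtr_sqr ler_wsqrtr// (bigD1 i)//= lerDl.
by apply: sumr_ge0 => j _; exact: sqr_ge0.
Qed.

Lemma eucl_move x y (i : 'I_m.+1) (t : R) :
  eucl (bdry_pt y - (t *: delta_mx 0 i + x)) ^+ 2 =
  eucl (bdry_pt y - x) ^+ 2 - 2 * t * (bdry_pt y - x) 0 i + t ^+ 2.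
Proof.
rewrite !eucl_sq (bigD1 i)//= [in RHS](bigD1 i)//=.
rewrite (eq_bigr (fun j => (bdry_pt y - x) 0 j ^+ 2)); last first.
  by move=> j ji; rewrite !mxE (negbTE ji) andbF mulr0 add0r.
by rewrite !mxE !eqxx/= mulr1; ring.
Qed.

Section at_point.
Variable x : 'rV[R]_m.+1.
Hypothesis x0 : 0 < last_coord x.
Local Notation h := (last_coord x).
Local Notation rho y := (eucl (bdry_pt y - x)).

Lemma rho_ge y : h <= rho y.
Proof.
have := le_coord_eucl (bdry_pt y - x) ord_max.
by rewrite mxE bdry_pt_last !mxE sub0r normrN gtr0_norm.
Qed.

Lemma rho_gt0 y : 0 < rho y.
Proof. exact: lt_le_trans (rho_ge y). Qed.

(** The triangle inequality, as |t| <= h / 2 <= rho / 2. *)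
Lemma rho_move_ge y i t : `|t| <= h / 2 ->
  rho y / 2 <= eucl (bdry_pt y - (t *: delta_mx 0 i + x)).
Proof.
move=> th.
have w := le_coord_eucl (bdry_pt y - x) i.
have tr : `|t| <= rho y / 2.
  by apply: (le_trans th); rewrite ler_pM2r ?invr_gt0// rho_ge.
rewrite -[leLHS]ger0_norm ?divr_ge0 ?eucl_ge0// -sqrtr_sqr ler_wsqrtr// -eucl_sq eucl_move.
have tw : t * (bdry_pt y - x) 0 i <= `|t| * rho y.
  by apply: (le_trans (ler_norm _)); rewrite normrM ler_wpM2l.
have -> : t ^+ 2 = `|t| ^+ 2 by rewrite real_normK ?num_real.
rewrite -[2 * t * _]mulrA; have := rho_gt0 y; have := normr_ge0 t.
move: (rho y) `|t| (t * _) tr tw => r u p ur pu u0 r0.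
have : 0 <= (r / 2 - u) * (3 * r / 2 - u) by rewrite mulr_ge0; lra.
nra.
Qed.

Lemma rho_powR y (b : R) : rho y `^ b = (h ^+ 2 + sqdist (coords x) y) `^ (b / 2).
Proof.
rewrite -eucl_bdry -powR_mulrn ?eucl_ge0// -powRrM.
by congr (_ `^ _); field.
Qed.

Lemma measurable_rho_powR (b : R) : measurable_fun setT (fun y => rho y `^ b).
Proof.
under eq_fun do rewrite rho_powR.
exact: measurable_dist_powR.
Qed.

End at_point.

End geometry.

(** * Differentiation under the integral sign *)

(** The bound that dominates the differentiated kernel uniformly near x: E is the
    distance after the move, r the one before, and u the relevant coordinate of
    the difference. One factor r^-1 is traded for h^-1 so that the
    integrability of |f| rho^-beta suffices. *)
Lemma derivative_kernel_le (R : realType) (beta u E r h : R) :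
  0 < beta -> 0 < h -> h <= r -> r / 2 <= E -> `|u| <= E ->
  `|beta * u * E `^ (- (beta + 2))| <= beta * 2 `^ (beta + 1) / h * r `^ (- beta).
Proof.
move=> b0 h0 hr rE uE.
have r0 : 0 < r by exact: lt_le_trans hr.
have r20 : 0 < r / 2 by rewrite divr_gt0.
have E0 : 0 < E by exact: lt_le_trans rE.
rewrite normrM (normrM beta) (gtr0_norm b0) -!mulrA.
apply: ler_wpM2l; first exact: ltW.
rewrite (ger0_norm (powR_ge0 E _)).
apply: (@le_trans _ _ (E `^ (- (beta + 1)))).
  apply: (@le_trans _ _ (E * E `^ (- (beta + 2)))).
    by apply: ler_wpM2r => //; exact: powR_ge0.
  rewrite -{1}(powRr1 (ltW E0)) -powRD; last by rewrite (gt_eqF E0) implybT.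
  by rewrite (_ : 1 - (beta + 2) = - (beta + 1)) ?lexx//; ring.
apply: (@le_trans _ _ ((r / 2) `^ (- (beta + 1)))).
  rewrite !powRN lef_pV2 ?posrE ?powR_gt0//.
  by apply: ge0_ler_powR; rewrite ?nnegrE ?(ltW E0) ?(ltW r20)// addr_ge0// ltW.
rewrite powRM ?invr_ge0//; last exact: ltW.
rewrite -[2^-1]powR_inv1// -powRrM mulN1r opprK mulrC.
apply: ler_wpM2l; first exact: powR_ge0.
rewrite opprD powRD; last by rewrite (gt_eqF r0) implybT.
rewrite mulrC; apply: ler_wpM2r; first exact: powR_ge0.
by rewrite (powR_inv1 (ltW r0)) lef_pV2 ?posrE.
Qed.

Lemma scaled_difference (R : realType) (k u a b : R) :
  k * (u *: (a - b)) = u *: (k * a - k * b).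
Proof. by rewrite /GRing.scale/= mulrCA mulrBr. Qed.

Section differentiation.
Context {R : realType} {m : nat}.
Local Notation Q := (measurableTypeR R).
Local Notation nu := (lebesgueRn R m).
Variables (beta : R) (x : 'rV[R]_m.+1) (f : m.-tuple Q -> R).
Hypotheses (b0 : 0 < beta) (x0 : 0 < last_coord x).
Hypotheses (mf : measurable_fun setT f).
Hypothesis intf : nu.-integrable setT (fun y => (f y * eucl (bdry_pt y - x) `^ (- beta))%:E).
Local Notation h := (last_coord x).
Local Notation rho y := (eucl (bdry_pt y - x)).
Variable i : 'I_m.+1.
Local Notation xt t := (t *: delta_mx 0 i + x).
Definition phi (t : R) (y : m.-tuple Q) : R := integrand beta f (xt t) y.
Local Notation w y := ((bdry_pt y - x) 0 i).

(** The derivative of [phi] in its first argument. *)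
Definition dphi (t : R) (y : m.-tuple Q) : R :=
  f y * (beta * (w y - t) * eucl (bdry_pt y - xt t) `^ (- (beta + 2))).

Lemma eucl_move_gt0 t y : `|t| <= h / 2 -> 0 < eucl (bdry_pt y - xt t).
Proof.
by move=> th; apply: lt_le_trans (rho_move_ge x0 y i th); rewrite divr_gt0// rho_gt0.
Qed.

Lemma is_derive_phi (t : R) y : `|t| <= h / 2 ->
  is_derive t 1 (phi ^~ y : R -> R) (dphi t y).
Proof.
move=> th; have E0 := eucl_move_gt0 y th.
pose P (t : R) := rho y ^+ 2 - 2 * t * w y + t ^+ 2.
have PE s : P s = eucl (bdry_pt y - xt s) ^+ 2 by rewrite eucl_move.
have P0 : 0 < P t by rewrite PE exprn_gt0.
(* The squared distance is a polynomial in the parameter, unlike the distance. *)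
have -> : phi ^~ y = (fun s => f y * P s `^ (- (beta / 2))).
  apply/funext => s; rewrite /phi /integrand PE -powR_mulrn ?eucl_ge0// -powRrM.
  by rewrite -powRN; congr (_ * _ `^ _); field.
have dP : is_derive t 1 P (- (2 * w y) + 2 * t).
  rewrite /P; apply: is_derive_eq.
  by rewrite /GRing.scale/=; ring.
have dp := is_derive1_powR (- (beta / 2)) P0.
have dc := is_derive1_comp dp dP.
have dz := is_deriveZ (f y) dc.
apply: (is_derive_eq dz).
rewrite /dphi /GRing.scale/=; congr (_ * _).
rewrite PE -powR_mulrn ?eucl_ge0// -powRrM.
rewrite (_ : 2%:R * (- (beta / 2) - 1) = - (beta + 2)); last by field.
by field.
Qed.

Lemma dphi0 :
  dphi 0 = (fun y => f y * (beta * w y * rho y `^ (- (beta + 2)))).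
Proof. by apply/funext => y; rewrite /dphi scale0r add0r subr0. Qed.

Lemma dphi_le t y : `|t| <= h / 2 ->
  `|dphi t y| <= beta * 2 `^ (beta + 1) / h * `|f y * rho y `^ (- beta)|.
Proof.
move=> th; have E0 := eucl_move_gt0 y th.
rewrite /dphi [leLHS]normrM [X in _ <= _ * X]normrM [leRHS]mulrCA.
apply: ler_wpM2l; first exact: normr_ge0.
rewrite (ger0_norm (powR_ge0 (rho y) _)).
apply: derivative_kernel_le => //; first exact: rho_ge.
  exact: rho_move_ge.
have := le_coord_eucl (bdry_pt y - xt t) i.
by rewrite !mxE !eqxx/= mulr1 opprD addrCA [- t + _]addrC.
Qed.

Lemma measurable_phi t : measurable_fun setT (phi t).
Proof.
rewrite /phi /integrand; under eq_fun do rewrite -powRN.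
by apply: measurable_funM => //; exact: measurable_rho_powR.
Qed.

Lemma phi_integrable t : `|t| <= h / 2 -> nu.-integrable setT (EFin \o phi t).
Proof.
move=> th.
have intg : nu.-integrable setT (fun y => ((2 `^ beta)%:E * (f y * rho y `^ (- beta))%:E)%E).
  exact: integrableZl.
apply: le_integrable intg => //.
- by apply/measurable_EFinP; exact: measurable_phi.
move=> y _; rewrite /= lee_fin /phi /integrand normrM normrM [X in _ <= _ * X]normrM mulrCA.
apply: ler_wpM2l; first exact: normr_ge0.
rewrite (ger0_norm (powR_ge0 (rho y) _)) (ger0_norm (powR_ge0 2 _)) normfV
  (ger0_norm (powR_ge0 (eucl (bdry_pt y - xt t)) _)).
have E0 := eucl_move_gt0 y th; have r0 := rho_gt0 x0 y.
rewrite -powRN; apply: (@le_trans _ _ ((rho y / 2) `^ (- beta))).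
  rewrite !powRN lef_pV2 ?posrE ?powR_gt0// ?divr_gt0//.
  apply: ge0_ler_powR; rewrite ?nnegrE.
  - exact: ltW.
  - by rewrite divr_ge0// ltW.
  - exact: ltW.
  - exact: rho_move_ge.
rewrite powRM ?invr_ge0//; last exact: ltW.
by rewrite -[2^-1]powR_inv1// -powRrM mulN1r opprK mulrC.
Qed.

Lemma cvg_potential (k : R) :
  (t^-1 *: (potential k beta f (xt t) - potential k beta f x)) @[t --> 0^'] -->
  k * \int[nu]_y dphi 0 y.
Proof.
pose G (y : m.-tuple Q) := beta * 2 `^ (beta + 1) / h * `|f y * rho y `^ (- beta)|.
have I0 : `](- (h / 2)), (h / 2)[%classic (0 : R).
  by rewrite /= in_itv/= oppr_lt0 divr_gt0.
have Ile t : `](- (h / 2)), (h / 2)[%classic t -> `|t| <= h / 2.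
  by rewrite /= in_itv/= => /andP[t1 t2]; rewrite ler_norml !ltW.
have intG : nu.-integrable setT (EFin \o G).
  rewrite (_ : EFin \o G = (fun y => (beta * 2 `^ (beta + 1) / h)%:E *
     (abse ((f y * rho y `^ (- beta))%:E)))%E); last first.
    by apply/funext => y /=; rewrite /G EFinM.
  by apply: integrableZl => //; exact: integrable_abse.
have G0 y : 0 <= G y.
  rewrite /G mulr_ge0// divr_ge0 ?(ltW x0)// mulr_ge0 ?powR_ge0//; exact: ltW.
have d1E t y : `|t| <= h / 2 -> partial1of2 phi t y = dphi t y.
  move=> th; rewrite partial1of2E.
  by have [_ ->] := is_derive_phi y th.
have Gub t y : `](- (h / 2)), (h / 2)[%classic t -> setT y ->
    `|partial1of2 phi t y| <= G y.
  by move=> It _; rewrite d1E; [exact/dphi_le/Ile|exact: Ile].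
have H := @cvg_differentiation_under_integral R _ _ nu phi setT measurableT 0
  (- (h / 2)) (h / 2) I0 (fun t It => phi_integrable (Ile t It))
  (fun t y It _ => @ex_derive _ _ _ _ _ _ _ (is_derive_phi y (Ile t It))) G G0 intG Gub.
have -> : \int[nu]_y dphi 0 y = \int[nu]_(y in setT) partial1of2 phi 0 y.
  by apply: eq_Rintegral => y _; rewrite d1E// normr0 divr_ge0// ltW.
pose F (t : R) := \int[nu]_y phi t y.
rewrite (_ : (fun t : R => _) = (fun t => k * (t^-1 *: (F (t + 0) - F 0)))).
  exact: cvgM (cvg_cst k) H.
have F0 : F 0 = \int[nu]_y integrand beta f x y.
  by rewrite /F /phi scale0r add0r.
apply/funext => t; rewrite F0 addr0 /potential.
exact: (esym (scaled_difference k _ _ _)).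
Qed.

Lemma derivable_potential (k : R) : derivable (potential k beta f) x (delta_mx 0 i).
Proof. by apply/cvg_ex; eexists; exact: cvg_potential. Qed.

Lemma partial_potential (k : R) :
  partial i (potential k beta f) x =
  k * \int[nu]_y (f y * (beta * w y * rho y `^ (- (beta + 2)))).
Proof.
transitivity (k * \int[nu]_y dphi 0 y).
  by apply: cvg_lim => //; exact: cvg_potential.
by rewrite dphi0.
Qed.

Lemma integrable_dphi0 : nu.-integrable setT
  (fun y => (f y * (beta * w y * rho y `^ (- (beta + 2))))%:E).
Proof.
have intg : nu.-integrable setT (fun y => ((beta * 2 `^ (beta + 1) / h)%:E *
    (f y * rho y `^ (- beta))%:E)%E).
  exact: integrableZl.
apply: le_integrable intg => //.
  apply/measurable_EFinP; apply: measurable_funM => //.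
  apply: measurable_funM; last exact: measurable_rho_powR.
  apply: measurable_funM => //.
  have -> : (fun y : m.-tuple Q => w y) = (fun y => nth 0 y i - x 0 i).
    by apply/funext => y; rewrite !mxE.
  apply: measurable_funB => //.
  have [im|im] := ltnP i m.
    have -> : (fun y : m.-tuple Q => nth 0 y i) = (fun y => tnth y (Ordinal im)).
      by apply/funext => y; rewrite (tnth_nth 0).
    exact: measurable_tnth.
  have -> : (fun y : m.-tuple Q => nth 0 y i) = (fun y => 0).
    by apply/funext => y; rewrite nth_default// size_tuple.
  exact: measurable_cst.
move=> y _; rewrite -EFinM !abse_EFin lee_fin.
have := @dphi_le 0 y; rewrite normr0 dphi0 => H.
apply: (le_trans (H _)); first by rewrite divr_ge0// ltW.
by rewrite [leRHS]normrM ler_wpM2r// ler_norm.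
Qed.

End differentiation.

(** * Cubes and Hoelder's inequality *)

Section cube.
Context {R : realType}.
Local Notation mu := (@lebesgue_measure R).
Local Notation Q := (measurableTypeR R).

(** Cubes rather than balls, because their preimages are rectangles. *)
Definition cube m (a : nat -> R) (d : R) : set (m.-tuple Q) :=
  [set y | forall i : 'I_m, `|tnth y i - a i| <= d].

Lemma lebesgueRn_cube m a d : 0 < d ->
  measurable (@cube m a d) /\ lebesgueRn R m (cube a d) = ((2 * d) ^+ m)%:E.
Proof.
move=> d0; elim: m a => [|m IH] a.
  have -> : @cube 0 a d = setT by apply/seteqP; split => // y _ [].
  by split => //=; rewrite diracT expr0.
have [mc ec] := IH (a \o S).
pose I : set Q := `[a 0%N - d, a 0%N + d]%classic.
have mI : measurable I by exact: measurable_itv.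
have E : @tuple_of_pair R m @^-1` (cube a d) = I `*` cube (a \o S) d.
  apply/seteqP; split => -[t y] /=; rewrite /cube/= /I/= in_itv/= -ler_distlC distrC.
    move=> H; split; first exact: (H ord0).
    by move=> i; have := H (lift ord0 i); rewrite tnthS.
  by move=> [H0 H1] i; case: (unliftP ord0 i) => [j ->|->//]; rewrite tnthS; exact: H1.
split.
  have -> : @cube m.+1 a d = @pair_of_tuple R m @^-1` (I `*` cube (a \o S) d).
    rewrite -E -comp_preimage (_ : _ \o _ = id) ?preimage_id//.
    apply/funext => y /=; rewrite /tuple_of_pair /pair_of_tuple/=.
    by case/tupleP: y => t y; apply/val_inj.
  rewrite -[X in measurable X]setTI.
  by apply: measurable_pair_of_tuple => //; exact: measurableX.
rewrite /= /lebesgue_cons /pushforward E product_measure1E// ec.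
transitivity ((2 * d)%:E * ((2 * d) ^+ m)%:E)%E; last by rewrite -EFinM exprS.
congr (_ * _)%E; transitivity (mu I) => //.
rewrite /I lebesgue_measure_itv/= lte_fin.
have -> : a 0%N - d < a 0%N + d by lra.
by rewrite -EFinB; congr (_%:E); ring.
Qed.

Lemma lebesgueRn_gt0 m : (0 < lebesgueRn R m setT)%E.
Proof.
have [mc ec] := @lebesgueRn_cube m (fun=> 0) 1 ltr01.
apply: (@lt_le_trans _ _ (lebesgueRn R m (cube (fun=> 0) 1))).
  by rewrite ec lte_fin exprn_gt0// mulr1.
by apply: le_measure; rewrite ?inE//.
Qed.

Lemma cube_sqdist m a d (y : m.-tuple Q) : cube a d y -> sqdist a y <= m%:R * d ^+ 2.
Proof.
move=> H; rewrite -[m in m%:R]card_ord -sumr_const mulr_suml.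
apply: ler_sum => i _; rewrite mul1r -real_normK ?num_real//.
by rewrite lerXn2r ?nnegrE// (le_trans _ (H i)).
Qed.

End cube.

Section hoelder_conjugate_pair.
Context d {T : measurableType d} {R : realType}.
Variable mu : {measure set T -> \bar R}.

(** [q] is the finite exponent conjugate to some [p > 1]; a real [q] keeps the
    exponents of the kernel out of the extended reals. *)
Definition conjugate_to (p : \bar R) (q : R) : Prop :=
  (p = +oo%E /\ q = 1) \/ (exists r, [/\ p = r%:E, 1 < r & q = r / (r - 1)]).

Lemma conjugate_to_ge1 p q : conjugate_to p q -> 1 <= q.
Proof.
move=> [[_ ->//]|[r [_ r1 ->]]].
by rewrite ler_pdivlMr ?subr_gt0// mul1r gerBl.
Qed.

(** For infinite p, |f| is almost everywhere below its essential supremum. *)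
Lemma hoelder_conj p q (f g : T -> R) : (0 < mu setT)%E -> conjugate_to p q ->
  f \in Lfun mu p -> measurable_fun setT g ->
  (\int[mu]_x `|f x * g x|%:E <=
   'N[mu]_p[EFin \o f] * (\int[mu]_x (`|g x| `^ q)%:E) `^ q^-1)%E.
Proof.
move=> muT pq; rewrite inE => /andP[]; rewrite inE /= => mf.
rewrite inE /= /finite_norm => nf mg.
move: nf; case: pq => [[-> ->]|[r [-> r1 ->]]] nf; last first.
  have r0 : 0 < r by exact: lt_trans r1.
  have r10 : 0 < r - 1 by rewrite subr_gt0.
  have := @hoelder _ _ _ mu f g r (r / (r - 1)) mf mg r0.
  rewrite divr_gt0// => /(_ isT).
  have -> : r^-1 + (r / (r - 1))^-1 = 1.
    by rewrite invf_div; field; rewrite (gt_eqF r0).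
  move=> /(_ erefl); rewrite Lnorm1 [in X in (_ <= _ * X)%E -> _]unlock /=.
  by [].
have Eg : ((\int[mu]_x (`|g x| `^ 1)%:E) `^ 1^-1 = \int[mu]_x `|g x|%:E)%E.
  rewrite invr1 poweRe1; last by apply: integral_ge0 => x _; rewrite lee_fin powR_ge0.
  by apply: eq_integral => x _; rewrite powRr1.
rewrite Eg.
move: nf; rewrite unlock /= muT /= => nf.
set M := ess_sup _ _ in nf *.
have M0 : (0 <= M)%E by apply: ess_sup_gee => //; apply: nearW => x /=.
have Mf : M \is a fin_num by rewrite ge0_fin_numE.
have mag : measurable_fun setT (fun x => `|g x|%:E).
  apply/measurable_EFinP.
  exact: (measurableT_comp (@normr_measurable R setT) mg).
rewrite -(fineK Mf) -ge0_integralZ ?fine_ge0//.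
apply: ae_ge0_le_integral => //.
- by apply/measurable_EFinP; apply: measurableT_comp => //; exact: measurable_funM.
- by move=> x _; rewrite mule_ge0// lee_fin fine_ge0.
- by apply: emeasurable_funM => //; exact: measurable_cst.
have := ess_sup_ge mu (abse \o (EFin \o f)); apply: filterS => x /= fM _.
by rewrite fineK// normrM EFinM lee_wpmul2r.
Qed.

End hoelder_conjugate_pair.

(** * Sharp dual bounds for the kernel *)

Section dual_bound.
Context {R : realType} {m : nat}.
Local Notation Q := (measurableTypeR R).
Local Notation nu := (lebesgueRn R m).
Variables (beta : R) (x : 'rV[R]_m.+1).
Hypotheses (b0 : 0 < beta) (x0 : 0 < last_coord x).
Local Notation h := (last_coord x).
Local Notation rho y := (eucl (bdry_pt y - x)).
Local Notation D y := (h ^+ 2 + sqdist (coords x) y).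

Definition dot (v : 'rV[R]_m.+1) (y : m.-tuple Q) : R :=
  \sum_i v 0 i * (bdry_pt y - x) 0 i.

(** What the theorem needs about an exponent p, up to the factor |k| beta. The
    third clause asks for near-extremal functions only, because for p = 1 the
    bound is not attained. *)
Definition sharp_dual_bound (p : \bar R) (C : R) : Prop :=
  [/\ forall f, f \in Lfun nu p ->
        nu.-integrable setT (fun y => (f y * rho y `^ (- beta))%:E),
      forall f v, f \in Lfun nu p -> eucl v = 1 ->
        (\int[nu]_y `|f y * (dot v y * rho y `^ (- (beta + 2)))|%:E
         <= C%:E * 'N[nu]_p[EFin \o f])%E &
      forall c, c < C -> exists f, [/\ f \in Lfun nu p,
        forall y, 0 <= f y, (0 < 'N[nu]_p[EFin \o f])%E &
        (c%:E * 'N[nu]_p[EFin \o f] <=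
         \int[nu]_y (f y * (h * rho y `^ (- (beta + 2))))%:E)%E]].

Lemma measurable_dot v : measurable_fun setT (dot v).
Proof.
rewrite (_ : dot v = (fun y => linform (coords v) (coords x) y - h * v 0 ord_max)).
  exact: measurable_height.
by apply/funext => y; exact: dot_bdry.
Qed.

(** Cauchy and Schwarz, from the coordinatewise inequality
    |a c| <= (rho a^2 + c^2 / rho) / 2. *)
Lemma dot_le v y : eucl v = 1 -> `|dot v y| <= rho y.
Proof.
move=> v1; have r0 := rho_gt0 x0 y.
apply: (le_trans (ler_norm_sum _ _ _)).
apply: (@le_trans _ _ (\sum_i (rho y / 2 * v 0 i ^+ 2 + (2 * rho y)^-1 * (bdry_pt y - x) 0 i ^+ 2))).
  apply: ler_sum => i _; rewrite normrM -(real_normK (num_real (v 0 i))).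
  rewrite -(real_normK (num_real ((bdry_pt y - x) 0 i))).
  move: (rho y) r0 `|_| `|_| => r r0 a c.
  rewrite -subr_ge0 (_ : _ - _ = (r * c - a) ^+ 2 / (2 * r)).
    by rewrite divr_ge0 ?sqr_ge0// mulr_ge0// ltW.
  by field; rewrite (gt_eqF r0).
rewrite big_split/= -!mulr_sumr -!eucl_sq v1 expr1n.
rewrite le_eqVlt; apply/orP; left; apply/eqP.
by field; rewrite (gt_eqF r0).
Qed.

(** The kernel is at most rho^-(beta+1), and near the foot point of x the kernel
    in the normal direction is close to h^-(beta+1), so that indicators of small
    cubes are nearly extremal. *)
Lemma sharp_dual_bound1 : (0 < m)%N -> sharp_dual_bound 1 (h `^ (- (beta + 1))).
Proof.
move=> m0.
have rpow y (b : R) : 0 <= b -> rho y `^ (- b) <= h `^ (- b).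
  move=> bge; have r0 := rho_gt0 x0 y.
  rewrite !powRN lef_pV2 ?posrE ?powR_gt0//.
  by apply: ge0_ler_powR; rewrite ?nnegrE ?(ltW x0) ?(ltW r0)// rho_ge.
split.
- move=> f f1; have /Lfun1_integrable fi := f1.
  have intg : nu.-integrable setT (fun y => ((h `^ (- beta))%:E * (f y)%:E)%E).
    exact: integrableZl.
  have mf : measurable_fun setT f by apply/measurable_EFinP; exact: measurable_int fi.
  apply: le_integrable intg => //.
    apply/measurable_EFinP; apply: measurable_funM => //.
    exact: measurable_rho_powR.
  move=> y _; rewrite -EFinM !abse_EFin lee_fin mulrC !normrM.
  apply: ler_wpM2r => //; rewrite !ger0_norm ?powR_ge0//; exact/rpow/ltW.
- move=> f v f1 v1; have /Lfun1_integrable fi := f1.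
  have mf : measurable_fun setT f by apply/measurable_EFinP; exact: measurable_int fi.
  rewrite Lnorm1 -ge0_integralZ ?powR_ge0//; last first.
    by apply: measurableT_comp => //; exact/measurable_EFinP.
  apply: ge0_le_integral => //.
  + apply/measurable_EFinP; apply: measurableT_comp => //.
    apply: measurable_funM => //; apply: measurable_funM; first exact: measurable_dot.
    exact: measurable_rho_powR.
  + apply: emeasurable_funM; first exact: measurable_cst.
    by apply: measurableT_comp => //; exact/measurable_EFinP.
  move=> y _; rewrite /= -EFinM lee_fin normrM mulrC; apply: ler_wpM2r => //.
  have r0 := rho_gt0 x0 y.
  apply: (@le_trans _ _ (rho y `^ (- (beta + 1)))); last by apply: rpow; rewrite addr_ge0// ltW.
  rewrite normrM (ger0_norm (powR_ge0 (rho y) _)).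
  apply: (@le_trans _ _ (rho y * rho y `^ (- (beta + 2)))).
    by apply: ler_wpM2r; [exact: powR_ge0|exact: dot_le].
  rewrite -{1}(powRr1 (ltW r0)) -powRD; last by rewrite (gt_eqF r0) implybT.
  by rewrite (_ : 1 - (beta + 2) = - (beta + 1)) ?lexx//; ring.
move=> c cC.
have b20 : 0 < beta + 2 by rewrite addr_gt0.
have m0R : 0 < m%:R :> R by rewrite ltr0n.
have [d d0 dc] : exists2 d, 0 < d & forall y, cube (coords x) d y ->
    c <= h * rho y `^ (- (beta + 2)).
  have [cneg|cpos] := leP c 0.
    exists 1 => // y _; apply: (le_trans cneg).
    by rewrite mulr_ge0 ?powR_ge0// ltW.
  (* B is the squared distance at which h rho^-(beta+2) drops to c; it exceeds
     h^2 since c < h^-(beta+1), and the half-side d of the cube uses up the gap. *)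
  pose B := (h / c) `^ (2 / (beta + 2)).
  have hc0 : 0 < h / c by rewrite divr_gt0.
  have Bh : h ^+ 2 < B.
    have -> : h ^+ 2 = (h `^ (beta + 2)) `^ (2 / (beta + 2)).
      by rewrite -powRrM mulrC divfK ?(gt_eqF b20)// powR_mulrn// ltW.
    apply: gt0_ltr_powR; rewrite ?nnegrE ?divr_gt0// ?powR_ge0 ?(ltW hc0)//.
    rewrite ltr_pdivlMr// -ltr_pdivlMl ?powR_gt0// -powRN.
    apply: (lt_le_trans cC).
    rewrite -[X in _ <= _ * X](powRr1 (ltW x0)) -powRD; last by rewrite (gt_eqF x0) implybT.
    by rewrite (_ : - (beta + 2) + 1 = - (beta + 1)) ?lexx//; ring.
  have Bm0 : 0 < (B - h ^+ 2) / m%:R by rewrite divr_gt0// subr_gt0.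
  exists (Num.sqrt ((B - h ^+ 2) / m%:R)); first by rewrite sqrtr_gt0.
  move=> y /cube_sqdist; rewrite sqr_sqrtr ?(ltW Bm0)// mulrC divfK ?(gt_eqF m0R)// => DB.
  have {}DB : D y <= B by rewrite -lerBrDl.
  have B0 : 0 < B by exact: powR_gt0.
  rewrite rho_powR -ler_pdivrMl// mulrC.
  have -> : c / h = B `^ (- (beta + 2) / 2).
    rewrite -powRrM (_ : 2 / (beta + 2) * (- (beta + 2) / 2) = -1); last first.
      by field; rewrite (gt_eqF b20).
    by rewrite powR_inv1 ?(ltW hc0)// invf_div.
  rewrite !mulNr !powRN lef_pV2 ?posrE ?powR_gt0// ?dist_sq_gt0//.
  apply: ge0_ler_powR; rewrite ?nnegrE ?(ltW B0)//.
    by rewrite divr_ge0// ltW.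
  exact/ltW/dist_sq_gt0.
have [mC eC] := @lebesgueRn_cube R m (coords x) d d0.
have mI : measurable_fun setT (\1_(cube (coords x) d) : m.-tuple Q -> R).
  exact: measurable_indic.
have intI : (\int[nu]_y (\1_(cube (coords x) d) y)%:E = nu (cube (coords x) d))%E.
  by rewrite integral_indic// setIT.
have nE : ('N[nu]_1[EFin \o \1_(cube (coords x) d)] = ((2 * d) ^+ m)%:E)%E.
  rewrite Lnorm1 -eC -intI.
  by apply: eq_integral => y _ /=; rewrite ger0_norm.
exists (\1_(cube (coords x) d)); split.
- rewrite inE; apply/andP; split; rewrite inE//=.
  by rewrite /finite_norm nE ltry.
- by move=> y.
- by rewrite nE lte_fin exprn_gt0// mulr_gt0.
have H0 y : 0 <= h * rho y `^ (- (beta + 2)).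
  by rewrite mulr_ge0 ?powR_ge0// ltW.
have [c0|c0] := leP 0 c; last first.
  apply: (@le_trans _ _ 0%E); last first.
    by apply: integral_ge0 => y _; rewrite lee_fin mulr_ge0.
  by rewrite nE -EFinM lee_fin nmulr_rle0// exprn_ge0// mulr_ge0// ltW.
have -> : (c%:E * 'N[nu]_1[EFin \o \1_(cube (coords x) d)] =
    \int[nu]_y (c%:E * (\1_(cube (coords x) d) y)%:E))%E.
  rewrite ge0_integralZ//; last exact/measurable_EFinP.
  by rewrite nE -eC -intI.
apply: ge0_le_integral => //.
- by move=> y _; rewrite -EFinM lee_fin mulr_ge0.
- by apply: emeasurable_funM; [exact: measurable_cst|exact/measurable_EFinP].
- apply/measurable_EFinP; apply: measurable_funM => //.
  by apply: measurable_funM; [exact: measurable_cst|exact: measurable_rho_powR].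
move=> y _; rewrite -EFinM lee_fin mulrC indicE.
case: (boolP (y \in cube _ _)) => [/set_mem/dc cle|_] /=; last by rewrite !mul0r.
by rewrite !mul1r.
Qed.

End dual_bound.

Section dual_bound_conjugate.
Context {R : realType} {m : nat}.
Local Notation Q := (measurableTypeR R).
Local Notation nu := (lebesgueRn R m).
Variables (beta : R) (x : 'rV[R]_m.+1) (p : \bar R) (q : R).
Hypotheses (b0 : 0 < beta) (x0 : 0 < last_coord x).
Hypotheses (pq : conjugate_to p q) (mq : m%:R < beta * q).
Local Notation h := (last_coord x).
Local Notation rho y := (eucl (bdry_pt y - x)).
Local Notation D y := (h ^+ 2 + sqdist (coords x) y).

(** The q-th power of the L^q norm of the kernel in the normal direction. *)
Definition height_mass : R :=
  kernel_constant m beta q * h `^ (m%:R - (beta + 1) * q).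

(** The kernel in the normal direction, up to sign. *)
Let H (y : m.-tuple Q) : R := h * rho y `^ (- (beta + 2)).

Let q1 : 1 <= q. Proof. exact: conjugate_to_ge1 pq. Qed.
Let q0 : 0 < q. Proof. exact: lt_le_trans q1. Qed.
Let mq2 : m%:R < (beta + 2) * q.
Proof. by rewrite mulrDl (lt_trans mq)// ltrDl mulr_gt0. Qed.

Lemma height_mass_gt0 : 0 < height_mass.
Proof.
by rewrite mulr_gt0 ?powR_gt0// kernel_constant_gt0// mulr_gt0// addr_gt0.
Qed.

Let H_gt0 y : 0 < H y.
Proof. by rewrite mulr_gt0// powR_gt0// rho_gt0. Qed.

Let mH : measurable_fun setT H.
Proof. by apply: measurable_funM; [exact: measurable_cst|exact: measurable_rho_powR]. Qed.

Lemma rho_powR_q y (b : R) : (rho y `^ (- b)) `^ q = D y `^ (- (b * q / 2)).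
Proof. by rewrite -powRrM rho_powR; congr (_ `^ _); field. Qed.

Lemma integral_height : (\int[nu]_y (H y `^ q)%:E)%E = height_mass%:E.
Proof.
rewrite /height_mass -(@kernel_integralE R m (coords x) h x0 q beta q0 mq2); apply: eq_integral => y _.
by rewrite /H powRM ?powR_ge0 ?(ltW x0)// rho_powR_q.
Qed.

Lemma kernel_norm_le v : eucl v = 1 ->
  (\int[nu]_y (`|dot x v y * rho y `^ (- (beta + 2))| `^ q)%:E <= height_mass%:E)%E.
Proof.
move=> v1; rewrite /height_mass -(@kernel_integralE R m (coords x) h x0 q beta q0 mq2).
under eq_integral => y _ do
  rewrite normrM (ger0_norm (powR_ge0 (rho y) _)) powRM ?powR_ge0// rho_powR_q /dot dot_bdry.
apply: kernel_integral_le => //.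
  by rewrite subr_gt0 -natr1 mulrDl mul1r ltr_leD.
by rewrite -eucl_coords v1 expr1n.
Qed.

(** The bound is Hoelder's inequality with [kernel_norm_le]; equality holds for
    the power q - 1 of the kernel in the normal direction, the constant 1 when
    q = 1. *)
Lemma sharp_dual_bound_conjugate : sharp_dual_bound beta x p (height_mass `^ q^-1).
Proof.
have nu0 := @lebesgueRn_gt0 R m.
have Nfin f : f \in Lfun nu p -> ('N[nu]_p[EFin \o f] < +oo)%E.
  by rewrite inE => /andP[_]; rewrite inE.
have mLfun f : f \in Lfun nu p -> measurable_fun setT f.
  by rewrite inE => /andP[]; rewrite inE.
split.
- move=> f fp; apply/integrableP; split.
    apply/measurable_EFinP; apply: measurable_funM; first exact: mLfun.
    exact: measurable_rho_powR.
  apply: (le_lt_trans (hoelder_conj nu0 pq fp (measurable_rho_powR _ _))).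
  have -> : (\int[nu]_y (`|rho y `^ (- beta)| `^ q)%:E =
      \int[nu]_y (D y `^ (- (beta * q / 2)))%:E)%E.
    by apply: eq_integral => y _; rewrite ger0_norm ?powR_ge0// rho_powR_q.
  rewrite integral_powR_sqdist ?ltr_pM2r ?invr_gt0// poweR_EFin.
  by rewrite lte_mul_pinfty ?Lnorm_ge0 ?ltry// ge0_fin_numE ?Lnorm_ge0 ?Nfin.
- move=> f v fp v1.
  have mg : measurable_fun setT (fun y => dot x v y * rho y `^ (- (beta + 2))).
    by apply: measurable_funM; [exact: measurable_dot|exact: measurable_rho_powR].
  apply: (le_trans (hoelder_conj nu0 pq fp mg)).
  rewrite muleC; apply: lee_wpmul2r; first exact: Lnorm_ge0.
  rewrite -poweR_EFin; apply: gt0_ler_poweR.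
  + by rewrite invr_ge0 ltW.
  + rewrite in_itv/= leey andbT; apply: integral_ge0 => y _.
    by rewrite lee_fin powR_ge0.
  + by rewrite in_itv/= leey andbT lee_fin ltW// height_mass_gt0.
  + exact: kernel_norm_le.
move=> c cC.
have I0 := height_mass_gt0.
have nE : ('N[nu]_p[EFin \o (fun y => (H y `^ (q - 1))%R)] = (height_mass `^ (1 - q^-1))%:E)%E.
  have [[-> ->]|[r [-> r1 qr]]] := pq.
    rewrite invr1 !subrr powRr0 unlock nu0.
    rewrite (_ : abse \o _ = cst 1%E) ?ess_sup_cst//.
    by apply/funext => y /=; rewrite powRr0 normr1.
  have r0 : 0 < r by exact: lt_trans r1.
  have r10 : 0 < r - 1 by rewrite subr_gt0.
  rewrite unlock (_ : 1 - q^-1 = r^-1); last first.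
    by rewrite qr invf_div; field; rewrite (gt_eqF r0).
  rewrite -poweR_EFin -integral_height; congr (_ `^ _)%E.
  apply: eq_integral => y _ /=; rewrite ger0_norm ?powR_ge0// -powRrM.
  congr ((_ `^ _)%:E); rewrite qr; field; by rewrite (gt_eqF r10).
exists (fun y => H y `^ (q - 1)); split.
- rewrite inE; apply/andP; split; rewrite inE/=; last by rewrite /finite_norm nE ltry.
  exact: (measurableT_comp (measurable_powR _) mH).
- by move=> y; exact: powR_ge0.
- by rewrite nE lte_fin powR_gt0.
have -> : (\int[nu]_y (H y `^ (q - 1) * H y)%:E)%E = height_mass%:E.
  rewrite -integral_height; apply: eq_integral => y _; congr (_%:E).
  rewrite -[X in _ * X](powRr1 (ltW (H_gt0 y))) -powRD ?subrK// (gt_eqF (H_gt0 y)).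
  by rewrite implybT.
rewrite nE -EFinM lee_fin; apply: (@le_trans _ _ (height_mass `^ q^-1 * height_mass `^ (1 - q^-1))).
  by apply: ler_wpM2r; [exact: powR_ge0|exact: ltW].
rewrite -powRD; last by rewrite (gt_eqF I0) implybT.
by rewrite addrCA subrr addr0 powRr1// ltW.
Qed.

End dual_bound_conjugate.

(** * The sharp constants *)

Section gradient.
Context {R : realType} {m : nat}.
Local Notation Q := (measurableTypeR R).
Local Notation nu := (lebesgueRn R m).
Variables (k beta : R) (x : 'rV[R]_m.+1) (p : \bar R) (C : R).
Hypotheses (b0 : 0 < beta) (x0 : 0 < last_coord x).
Hypothesis dual : sharp_dual_bound beta x p C.
Local Notation h := (last_coord x).
Local Notation rho y := (eucl (bdry_pt y - x)).
Local Notation u f := (potential k beta f).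

Let mLfun (f : m.-tuple Q -> R) : f \in Lfun nu p -> measurable_fun setT f.
Proof. by rewrite inE => /andP[]; rewrite inE. Qed.

Let intf f : f \in Lfun nu p ->
  nu.-integrable setT (fun y => (f y * rho y `^ (- beta))%:E).
Proof. by have [+ _ _] := dual; apply. Qed.

(** Linearity assembles the partial derivatives into a single integral, to which
    the dual bound applies in the direction v. *)
Lemma grad_dot f (v : 'rV[R]_m.+1) : f \in Lfun nu p ->
  (\sum_i v 0 i * grad (u f) x 0 i)%:E =
  ((k * beta)%:E * \int[nu]_y (f y * (dot x v y * rho y `^ (- (beta + 2))))%:E)%E.
Proof.
move=> fp; have mf := mLfun fp; have ifp := intf fp.
pose phi i y := f y * (beta * (bdry_pt y - x) 0 i * rho y `^ (- (beta + 2))).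
have iphi i : nu.-integrable setT (EFin \o phi i).
  exact: (integrable_dphi0 b0 x0 mf ifp i).
have iv i : nu.-integrable setT (fun y => ((v 0 i)%:E * (phi i y)%:E)%E).
  exact: (integrableZl _ _ (iphi i)).
have E : (\sum_i v 0 i * grad (u f) x 0 i) = k * (\sum_i v 0 i * \int[nu]_y phi i y).
  rewrite mulr_sumr; apply: eq_bigr => i _.
  by rewrite mxE (partial_potential b0 x0 mf ifp) mulrCA.
have F : (\sum_i v 0 i * \int[nu]_y phi i y)%:E =
    (\int[nu]_y (\sum_i (v 0 i)%:E * (phi i y)%:E))%E.
  rewrite integral_sum// -sumEFin; apply: eq_bigr => i _.
  rewrite EFinM integralZl//; last exact: iphi.
  by rewrite /Rintegral fineK// integrable_fin_num//; exact: iphi.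
rewrite E EFinM F [in RHS]EFinM -muleA; congr (_ * _)%E.
have idot : nu.-integrable setT (fun y => (f y * (dot x v y * rho y `^ (- (beta + 2))))%:E).
  have is_ : nu.-integrable setT (fun y => (beta^-1)%:E * (\sum_i (v 0 i)%:E * (phi i y)%:E))%E.
    by apply: integrableZl => //; apply: integrable_sum => // i _; exact: iv.
  apply: eq_integrable is_ => // y _.
  under eq_bigr do rewrite -EFinM.
  rewrite sumEFin -EFinM; congr (_%:E).
  rewrite /dot mulr_suml !mulr_sumr; apply: eq_bigr => i _.
  by rewrite /phi; field; rewrite (gt_eqF b0).
rewrite -integralZl//; apply: eq_integral => y _.
under eq_bigr do rewrite -EFinM.
rewrite sumEFin -EFinM; congr (_%:E).
rewrite /dot mulr_suml !mulr_sumr; apply: eq_bigr => i _.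
by rewrite /phi; ring.
Qed.

(** Take v to be the unit vector in the direction of the gradient. *)
Lemma eucl_grad_le f : f \in Lfun nu p ->
  ((eucl (grad (u f) x))%:E <= (`|k| * beta * C)%:E * 'N[nu]_p[EFin \o f])%E.
Proof.
move=> fp; set g := grad (u f) x.
have N0 : (0 <= 'N[nu]_p[EFin \o f])%E by exact: Lnorm_ge0.
have Nf : 'N[nu]_p[EFin \o f]%E \is a fin_num.
  by rewrite ge0_fin_numE//; move: fp; rewrite inE => /andP[_]; rewrite inE.
have [_ bound _] := dual.
have key v : eucl v = 1 -> ((\sum_i v 0 i * g 0 i)%:E <=
    (`|k| * beta * C)%:E * 'N[nu]_p[EFin \o f])%E.
  move=> v1; rewrite grad_dot//.
  apply: (le_trans (lee_abs _)); rewrite abseM /= normrM (gtr0_norm b0).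
  rewrite [X in (_ <= X * _)%E]EFinM -muleA; apply: lee_wpmul2l.
    by rewrite lee_fin mulr_ge0// ltW.
  apply: (le_trans _ (bound f v fp v1)).
  apply: (le_trans (le_abse_integral _ _ _)) => //.
  apply/measurable_EFinP; apply: measurable_funM; first exact: mLfun.
  by apply: measurable_funM; [exact: measurable_dot|exact: measurable_rho_powR].
have [g0|gn0] := eqVneq (eucl g) 0.
  (* Any unit vector shows that the right-hand side is nonnegative. *)
  pose e : 'rV[R]_m.+1 := delta_mx 0 ord_max.
  have e1 : eucl e = 1.
    rewrite /eucl (bigD1 ord_max)//= big1 => [|i /negbTE im]; last first.
      by rewrite mxE im andbF expr0n.
    by rewrite mxE !eqxx expr1n addr0 sqrtr1.
  rewrite g0; apply: le_trans (key e e1).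
  rewrite lee_fin (bigD1 ord_max)//= big1 => [|i /negbTE im]; last first.
    by rewrite mxE im andbF mul0r.
  have := le_coord_eucl g ord_max; rewrite g0 normr_le0 => /eqP ->.
  by rewrite mulr0 addr0.
have gpos : 0 < eucl g by rewrite lt_neqAle eq_sym gn0 eucl_ge0.
pose v := (eucl g)^-1 *: g.
have sumE : \sum_i v 0 i * g 0 i = eucl g.
  transitivity ((eucl g)^-1 * eucl g ^+ 2); last by field.
  rewrite eucl_sq mulr_sumr; apply: eq_bigr => i _.
  by rewrite /v mxE expr2 mulrA.
have v1 : eucl v = 1.
  rewrite /eucl (_ : \sum_i _ = 1) ?sqrtr1//.
  transitivity ((eucl g)^-2 * eucl g ^+ 2); last by field.
  rewrite [X in _ * X]eucl_sq mulr_sumr; apply: eq_bigr => i _.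
  by rewrite /v mxE exprMn exprVn.
by have := key v v1; rewrite sumE.
Qed.

(** In the normal direction w . v is the constant h, up to sign. *)
Lemma norm_partial_last f : f \in Lfun nu p ->
  (`|partial ord_max (u f) x|%:E =
  (`|k| * beta)%:E * `|\int[nu]_y (f y * (h * rho y `^ (- (beta + 2))))%:E|)%E.
Proof.
move=> fp; pose e : 'rV[R]_m.+1 := - delta_mx 0 ord_max.
have := grad_dot e fp.
have -> : \sum_i e 0 i * grad (u f) x 0 i = - partial ord_max (u f) x.
  rewrite (bigD1 ord_max)//= big1 => [|i /negbTE im]; last first.
    by rewrite !mxE im andbF oppr0 mul0r.
  by rewrite !mxE !eqxx addr0 mulN1r.
move=> /(congr1 abse); rewrite abseM /= normrN normrM (gtr0_norm b0) => ->.
congr (_ * `| _ |)%E; apply: eq_integral => y _; congr ((_ * (_ * _))%:E).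
rewrite /dot (bigD1 ord_max)//= big1 => [|i /negbTE im]; last first.
  by rewrite !mxE im andbF oppr0 mul0r.
by rewrite addr0 [X in _ * X]mxE bdry_pt_last !mxE !eqxx/= add0r mulrNN mul1r.
Qed.

(** The normal derivative is bounded by the gradient, so that the upper bound is
    needed for the gradient and the lower bound for the normal derivative only. *)
Lemma sharp_constant_potential (e : R) :
  e = 2 - m.+1%:R + beta + Defs.over (m.+1%:R - 1) p ->
  let C' := `|k| * beta * (C * h `^ e) in
  sharp_constant (valid_constant k beta p x (fun w => eucl (grad w x))) C' /\
  sharp_constant (valid_constant k beta p x (fun w => `|partial ord_max w x|)) C'.
Proof.
move=> eE C'; have he0 : 0 < h `^ e by exact: powR_gt0.
have vg : valid_constant k beta p x (fun w => eucl (grad w x)) C'.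
  move=> f fp; rewrite -eE /C' (_ : _ / _ = `|k| * beta * C); first exact: eucl_grad_le.
  by field; rewrite (gt_eqF he0).
have gn D : valid_constant k beta p x (fun w => eucl (grad w x)) D ->
    valid_constant k beta p x (fun w => `|partial ord_max w x|) D.
  move=> vD f fp; apply: le_trans (vD f fp); rewrite lee_fin.
  by have := le_coord_eucl (grad (u f) x) ord_max; rewrite mxE.
suff low : lbound (valid_constant k beta p x (fun w => `|partial ord_max w x|)) C'.
  split; split => //; last exact: gn.
  by move=> D /gn; exact: low.
move=> D vD; rewrite leNgt; apply/negP => DC.
have kb0 : 0 <= `|k| * beta by rewrite mulr_ge0// ltW.
(* When k = 0 the derivative and the claimed constant vanish, and a constant
   below 0 fails for any f of positive norm. *)
have [c cC Dc] : exists2 c, c < C & D / h `^ e < `|k| * beta * c \/ (D < 0 /\ k = 0).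
  have [k0|kn0] := eqVneq k 0.
    exists (C - 1); first by rewrite gtrBl.
    by right; split => //; move: DC; rewrite /C' k0 normr0 !mul0r.
  have kb : 0 < `|k| * beta by rewrite mulr_gt0// normr_gt0.
  have H : D / h `^ e / (`|k| * beta) < C.
    rewrite ltr_pdivrMr// ltr_pdivrMr// (_ : _ * _ * _ = C')//.
    by rewrite /C'; ring.
  set T := _ / _ in H; exists ((T + C) / 2); first by lra.
  left; rewrite -ltr_pdivrMl// [ltLHS]mulrC -/T; lra.
have [_ _ /(_ c cC)[f [fp f0 N0 cN]]] := dual.
have Nf : 'N[nu]_p[EFin \o f]%E \is a fin_num.
  by rewrite gt0_fin_numE//; move: fp; rewrite inE => /andP[_]; rewrite inE.
have := vD f fp; rewrite -eE norm_partial_last//.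
rewrite gee0_abs; last first.
  by apply: integral_ge0 => y _; rewrite lee_fin !mulr_ge0 ?powR_ge0// ltW.
move=> up; have {}up : ((`|k| * beta)%:E * (c%:E * 'N[nu]_p[EFin \o f]) <=
    (D / h `^ e)%:E * 'N[nu]_p[EFin \o f])%E.
  by apply: le_trans up; apply: lee_wpmul2l.
move: up N0; rewrite -(fineK Nf) -!EFinM lee_fin lte_fin => up N0.
move: up; rewrite mulrA ler_pM2r//.
case: Dc => [lt|[D0 k0]]; first by rewrite leNgt lt.
rewrite k0 normr0 !mul0r leNgt.
by rewrite nmulr_rlt0// invr_gt0 he0.
Qed.

End gradient.

(** Every admissible p other than 1 has a finite conjugate exponent q, and the
    three cases say that rho^-beta is in L^q: beta q > m. *)
Lemma admissible_cases (R : realType) (m : nat) (beta : R) (p : \bar R) :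
  (0 < m)%N -> admissible m.+1 beta p ->
  0 < beta /\ (p = 1%E \/ exists q, conjugate_to p q /\ m%:R < beta * q).
Proof.
move=> m0; rewrite /admissible -natr1 addrK.
have m0R : 0 < m%:R :> R by rewrite ltr0n.
case.
- case: p => [r| |] [mb r1 plt] //.
  have {}r1 : 1 <= r by rewrite -lee_fin.
  have b0 : 0 < beta by exact: lt_le_trans mb.
  split => //; move: r1; rewrite le_eqVlt => /predU1P[<-|r1]; [by left|right].
  have r10 : 0 < r - 1 by rewrite subr_gt0.
  exists (r / (r - 1)); split; first by right; exists r.
  apply: (le_lt_trans mb); rewrite ltr_pMr// ltr_pdivlMr// mul1r gtrBl//.
- move=> [mb ->]; split; first exact: lt_trans mb.
  by right; exists 1; split; [left|rewrite mulr1].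
- case: p => [r| |] [bm r1 rm] //.
  have {}r1 : 1 <= r by rewrite -lee_fin.
  have {}rm : r < m%:R / (m%:R - beta) by rewrite -lte_fin.
  have mb0 : 0 < m%:R - beta by rewrite subr_gt0.
  have r0 : 0 < r by exact: lt_le_trans r1.
  have rm' : r * (m%:R - beta) < m%:R by rewrite -ltr_pdivlMr.
  have b0 : 0 < beta by nra.
  split => //; move: r1; rewrite le_eqVlt => /predU1P[<-|r1]; [by left|right].
  have r10 : 0 < r - 1 by rewrite subr_gt0.
  exists (r / (r - 1)); split; first by right; exists r.
  by rewrite mulrA ltr_pdivlMr//; nra.
Qed.

(** The arguments of Gamma for finite and for infinite p agree once expressed
    through q. *)
Lemma C0_conjugate (R : realType) (m : nat) (k beta : R) (p : \bar R) (q : R) :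
  conjugate_to p q -> 0 <= kernel_constant m beta q ->
  C0 m.+1 k beta p = `|k| * beta * kernel_constant m beta q `^ q^-1.
Proof.
have e0 : (m.+1%:R - 1) / 2 = m%:R / 2 :> R by rewrite -natr1 addrK.
move=> [[-> ->]|[r [-> r1 ->]]]; rewrite /kernel_constant => A0; rewrite /C0 e0.
  have e1 : (beta - m.+1%:R + 3) / 2 = (beta + 2) / 2 - m%:R / 2.
    by rewrite -natr1; field.
  by rewrite mulr1 in A0 *; rewrite invr1 (powRr1 A0) e1.
have r10 : 0 < r - 1 by rewrite subr_gt0.
have rnz : (r == 0) = false by rewrite gt_eqF// (lt_trans _ r1).
have rnz1 : (r - 1 == 0) = false by rewrite gt_eqF.
rewrite (gt_eqF r1) invf_div.
have -> : ((beta - m.+1%:R + 3) * r + m.+1%:R - 1) / (2 * (r - 1)) =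
    (beta + 2) * (r / (r - 1)) / 2 - m%:R / 2.
  by rewrite -natr1; field; rewrite rnz1.
have -> : (beta + 2) * r / (2 * (r - 1)) = (beta + 2) * (r / (r - 1)) / 2.
  by field; rewrite rnz1.
by [].
Qed.

Theorem theorem2 (R : realType) (n : nat) (hn : (3 <= n)%N) (k beta : R)
    (p : \bar R) (hp : admissible n beta p)
    (x : 'rV[R]_n.-1.+1) (hx : 0 < last_coord x) :
  (forall f : n.-1.-tuple (measurableTypeR R) -> R,
     f \in Lfun (lebesgueRn R n.-1) p ->
     (lebesgueRn R n.-1).-integrable setT
       (fun y => (integrand beta f x y)%:E)
     /\ forall i : 'I_n.-1.+1,
          derivable (potential k beta f) x (delta_mx 0 i))
  /\ sharp_constant
       (valid_constant k beta p x (fun u => eucl (grad u x)))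
       (C0 n k beta p)
  /\ sharp_constant
       (valid_constant k beta p x (fun u => `|partial ord_max u x|))
       (C0 n k beta p).
Proof.
case: n hn hp x hx => [//|m] hn hp x hx.
have m0 : (0 < m)%N by rewrite -ltnS (leq_trans _ hn).
have [b0 cases] := admissible_cases m0 hp.
pose e := 2 - m.+1%:R + beta + Defs.over (m.+1%:R - 1) p.
have [C [dual CE]] : exists C, sharp_dual_bound beta x p C /\
    C0 m.+1 k beta p = `|k| * beta * (C * last_coord x `^ e).
  rewrite /e; case: cases => [->|[q [pq mq]]].
    exists (last_coord x `^ (- (beta + 1))); split; first exact: sharp_dual_bound1.
    rewrite /C0 eqxx /Defs.over divr1 -powRD; last by rewrite (gt_eqF hx) implybT.
    have -> : - (beta + 1) + (2 - m.+1%:R + beta + (m.+1%:R - 1)) = 0.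
      by rewrite -natr1; ring.
    by rewrite powRr0 mulr1.
  exists (height_mass beta x q `^ q^-1); split; first exact: sharp_dual_bound_conjugate.
  have q1 := conjugate_to_ge1 pq.
  have q0 : 0 < q by exact: lt_le_trans q1.
  have mq2 : m%:R < (beta + 2) * q by rewrite mulrDl (lt_trans mq)// ltrDl mulr_gt0.
  have A0 : 0 <= kernel_constant m beta q.
    by rewrite ltW// kernel_constant_gt0// mulr_gt0// addr_gt0.
  rewrite /height_mass.
  have overE : Defs.over (m.+1%:R - 1) p = m%:R * (1 - q^-1).
    have [[-> ->]|[r [-> r1 ->]]] := pq; first by rewrite /Defs.over invr1 subrr mulr0.
    have r10 : 0 < r - 1 by rewrite subr_gt0.
    have r0 : 0 < r by exact: lt_trans r1.
    by rewrite /Defs.over -natr1 addrK invf_div; field; rewrite (gt_eqF r0).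
  have hE : (last_coord x `^ (m%:R - (beta + 1) * q)) `^ q^-1 *
      last_coord x `^ (2 - m.+1%:R + beta + Defs.over (m.+1%:R - 1) p) = 1.
    rewrite overE -powRrM -powRD; last by rewrite (gt_eqF hx) implybT.
    rewrite -[RHS](powRr0 (last_coord x)) -natr1; congr (_ `^ _).
    by field; rewrite (gt_eqF q0).
  rewrite powRM ?powR_ge0// -[X in _ = _ * X]mulrA hE mulr1.
  exact: C0_conjugate.
have [grads parts] := sharp_constant_potential k b0 hx dual (erefl e).
split; last by rewrite CE.
move=> f fp; have [+ _ _] := dual => /(_ f fp) intf.
have mf : measurable_fun setT f by move: fp; rewrite inE => /andP[]; rewrite inE.
split; last by move=> i; exact: derivable_potential.
apply: eq_integrable intf => // y _.
by rewrite /integrand powRN.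
Qed.
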